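(* Let $I$ be an arbitrary non-empty set and let $(T_i)_{i\in I}$ be commuting $C_0$-semigroups over a Hilbert space $\mathcal{H}$ with bounded generators $(A_i)_{i\in I}\subseteq\mathfrak{L}(\mathcal{H})$. Then $(T_i)_{i\in I}$ has a simultaneous regular unitary dilation if and only if the generators of $(T_i)_{i\in I}$ are completely dissipative.
   Context: Hilbert spaces are complex; $\mathfrak{L}(\mathcal{H})$ and $\mathfrak{L}(\mathcal{H},\mathcal{H}')$ denote bounded operators. $C_0$-semigroups here are one-parameter, i.e. strongly continuous $T_i:\mathbb{R}_{\geq 0}\to\mathfrak{L}(\mathcal{H})$; commuting means $T_i(s)T_j(t)=T_j(t)T_i(s)$ for all $i,j\in I$, $s,t\geq 0$ (the bounded generators then commute as well). $(T_i)_{i\in I}$ has a simultaneous regular unitary dilation if there exist a Hilbert space $\mathcal{H}'$, commuting unitary $C_0$-semigroups $(U_i)_{i\in I}$ over $\mathcal{H}'$ (extended in the usual way to strongly continuous representations of $(\mathbb{R},+,0)$), and $r\in\mathfrak{L}(\mathcal{H},\mathcal{H}')$ (necessarily isometric), such that $$\Big(\prod_{i:\,t_i<0}T_i(-t_i)\Big)^{*}\Big(\prod_{i:\,t_i>0}T_i(t_i)\Big)=r^{*}\Big(\prod_{i\in K}U_i(t_i)\Big)r$$ for all finite $K\subseteq I$ and all $\mathbf{t}=(t_i)_{i\in K}\in\mathbb{R}^{K}$ (empty products are $I$, the identity operator). For finite $K\subseteq I$ define $$S_{(T_i)_{i\in I},K}=2^{-|K|}\sum_{(C_1,C_2)}\Big(\prod_{i\in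 C_1}(-A_i)\Big)^{*}\Big(\prod_{i\in C_2}(-A_i)\Big),$$ the sum running over all ordered pairs $(C_1,C_2)$ of disjoint, possibly empty sets with $C_1\cup C_2=K$. The generators of $(T_i)_{i\in I}$ are completely dissipative if $S_{(T_i)_{i\in I},K}\geq 0$ (positive semi-definite) for all finite $K\subseteq I$. *)

(* Defs.v *)
From HB Require Import structures.
From mathcomp Require Import all_boot all_order all_algebra finmap.
From mathcomp Require Import complex.
From mathcomp Require Import all_classical all_reals all_analysis.

Set Implicit Arguments.
Unset Strict Implicit.
Unset Printing Implicit Defensive.

Import Order.TTheory GRing.Theory Num.Theory.
Import numFieldNormedType.Exports.
Local Open Scope classical_set_scope.
Local Open Scope complex_scope.
Local Open Scope ring_scope.

(* The inner product is linear in its first argument and conjugate linear in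
   its second one. *)
Record hilbertType (R : realType) := HilbertType {
  hilbert_sort :> completeNormedModType R[i];
  dotp : {dot hilbert_sort for conjc};
  normE : forall x : hilbert_sort, `|x| ^+ 2 = dotp x x }.

Arguments dotp {R h}.

Section operators.
Context {R : realType}.

Definition bounded_op (H H' : hilbertType R) (f : H -> H') : Prop :=
  linear f /\ exists M : R, forall x, `|f x| <= M%:C * `|x|.

(* By the Riesz representation theorem, if f is a bounded operator, then the
   set below is a singleton for every y, so the default value 0 is not used. *)
Definition adjoint (H H' : hilbertType R) (f : H -> H') : H' -> H :=
  fun y => xget 0 [set z : H | forall x : H, dotp (f x) y = dotp x z].

Definition unitary (H : hilbertType R) (f : H -> H) : Prop :=
  [/\ bounded_op f, adjoint f \o f = idfun & f \o adjoint f = idfun].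

(* The order of R[i] makes 0 <= z mean that z is real and nonnegative. *)
Definition positive_op (H : hilbertType R) (f : H -> H) : Prop :=
  forall x : H, 0 <= dotp (f x) x.

(* The factors are composed in the order of the enumeration of J; this order
   is immaterial as the factors commute wherever prod_op is used. *)
Definition prod_op (H : hilbertType R) (J : finType) (P : {pred J})
    (f : J -> H -> H) : H -> H :=
  \big[(fun g h => g \o h)/idfun]_(j | P j) f j.

End operators.

Section semigroups.
Context {R : realType}.

(* A family indexed by the nonnegative reals is encoded by a function on R
   whose values at negative reals are unconstrained and never used. *)
Definition C0_semigroup (H : hilbertType R) (T : R -> H -> H) : Prop :=
  [/\ forall t, 0 <= t -> bounded_op (T t),
      T 0 = idfun,
      forall s t, 0 <= s -> 0 <= t -> T (s + t) = T s \o T t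
    & forall x : H, {within [set t : R | 0 <= t], continuous (T ^~ x)}].

Definition bounded_generator (H : hilbertType R) (T : R -> H -> H)
    (A : H -> H) : Prop :=
  bounded_op A /\
  forall x : H, (h^-1)%:C *: (T h x - x) @[h --> (0 : R)^'+] --> A x.

Definition commuting (H : hilbertType R) (I : Type) (T : I -> R -> H -> H) :
    Prop :=
  forall i j s t, 0 <= s -> 0 <= t -> T i s \o T j t = T j t \o T i s.

(* For unitary U (- t), the adjoint is the inverse. *)
Definition extend_group (H : hilbertType R) (U : R -> H -> H) : R -> H -> H :=
  fun t => if 0 <= t then U t else adjoint (U (- t)).

Definition regular_unitary_dilation (H : hilbertType R) (I : choiceType)
    (T : I -> R -> H -> H) : Prop :=
  exists (H' : hilbertType R) (U : I -> R -> H' -> H') (r : H -> H'),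
    [/\ forall i, C0_semigroup (U i),
        forall i t, 0 <= t -> unitary (U i t),
        commuting U,
        bounded_op r
      & forall (K : {fset I}) (t : K -> R),
          adjoint (prod_op (fun i : K => t i < 0)
                           (fun i : K => T (val i) (- t i)))
            \o prod_op (fun i : K => 0 < t i)
                       (fun i : K => T (val i) (t i))
          = adjoint r
            \o prod_op predT (fun i : K => extend_group (U (val i)) (t i))
            \o r].

Definition dissipation_op (H : hilbertType R) (I : choiceType)
    (A : I -> H -> H) (K : {fset I}) : H -> H :=
  (2 ^- #|` K|) *:
  \sum_(C : {set K} * {set K} |
          [disjoint C.1 & C.2] && (C.1 :|: C.2 == finset.setT))
     (adjoint (prod_op (mem C.1) (fun i : K => - A (val i)))
        \o prod_op (mem C.2) (fun i : K => - A (val i))).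

Definition completely_dissipative (H : hilbertType R) (I : choiceType)
    (A : I -> H -> H) : Prop :=
  forall K : {fset I}, positive_op (dissipation_op A K).

End semigroups.

(* Main.v *)
Require Import Defs.
From HB Require Import structures.
From mathcomp Require Import all_boot all_order all_algebra finmap.
From mathcomp Require Import complex ring lra.
From mathcomp Require Import all_classical all_reals all_analysis.

(** For a bounded sesquilinear form Q on H let

      L_i Q (x, y) = - (Q (A_i x, y) + Q (x, A_i y)),
      D_i,t Q (x, y) = Q (x, y) - Q (T_i(t) x, T_i(t) y),

    called dissipation and decrease below. The iterated dissipation L_K of the
    inner product is the form of 2 ^ |K| times the dissipation operator S_K, by
    expanding it over the subsets of K; the order of the factors does not
    matter as the generators commute. Complete dissipativity is therefore the
    positivity of all these forms (completely_dissipativeP). The iterated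
    decrease D_K,t of the inner product is the Brehmer form of the operators
    T_i(t_i). The two are related in both directions: D_i,t Q / t tends to
    L_i Q as t decreases to 0 (decrease_quotient_cvg), and conversely, if
    L_i Q is positive, then Q (T_i(t) x, T_i(t) x) decreases in t because of the
    sign of its right derivative, so D_i,t Q is positive (decrease_ge0).

    Suppose that there is a regular unitary dilation (U_i), r. The alternating
    sum of the vectors U_C(t_C)^-1 r (T_C(t_C) x) over the subsets C of K has
    the squared norm D_K,t (x, x), where t_C is the restriction of t to C
    (dotp_brehmer_vector). Hence the Brehmer forms are positive, and dividing
    by the times and letting them tend to 0 yields the positivity of L_K
    (dissipation_seq_cat_ge0).

    Conversely, suppose that the generators are completely dissipative. A
    dilation must be spanned by vectors U(g) r x, with g a finitely supported
    family of times, whose inner products are given by the kernel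

      ((g, x), (g', y)) |-> <T((g - g')_+) x, T((g' - g)_+) y>.

    The point is that this kernel is positive definite (regular_kernel_psd).
    This is proved by induction on the number of indices, together with the
    analogous claim for every form Q such that all L_J Q are positive. One
    index i is removed by sorting the pairs (g, x) by the time g_i and
    comparing the double sum with the one where all vectors are moved by T_i to
    a common time; the losses are double sums for the forms D_i,t Q, which
    satisfy the hypothesis for the remaining indices, because L_J D_i,t Q =
    D_i,t L_J Q and L_i L_J Q is positive. The kernel then has a reproducing
    kernel Hilbert space, and translations of the times are symmetries of the
    kernel, hence act by commuting unitaries, which are strongly continuous
    because the semigroups are. The vectors given by the points (0, x) embed
    H. *)

Set Implicit Arguments.
Unset Strict Implicit.
Unset Printing Implicit Defensive.

Import Order.TTheory GRing.Theory Num.Theory.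
Import numFieldNormedType.Exports.
Local Open Scope classical_set_scope.
Local Open Scope complex_scope.
Local Open Scope ring_scope.

Local Notation Re := complex.Re.
Local Notation Im := complex.Im.
Local Notation "z ^*" := (conjc z) : ring_scope.

(** * Limits in the complex numbers *)

Lemma cvg_oppD (K : numFieldType) (T : Type) (F : set_system T)
    (FF : Filter F) (a b : T -> K^o) (l m : K^o) :
  a t @[t --> F] --> l -> b t @[t --> F] --> m ->
  - (a t + b t) @[t --> F] --> (- (l + m) : K^o).
Proof. by move=> al bm; apply: cvgN; exact: cvgD. Qed.

Lemma cvg0_bilinear (K : numFieldType) (T : Type) (F : set_system T)
    (FF : Filter F) (a b d : T -> K^o) (m c l : K^o) :
  a t @[t --> F] --> (0 : K^o) -> b t @[t --> F] --> l ->
  d t @[t --> F] --> (0 : K^o) ->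
  m * (a t * b t + c * d t) @[t --> F] --> (0 : K^o).
Proof.
move=> a0 bl d0; rewrite -[0](mulr0 m) -[0 in X in _ --> X](addr0 0).
rewrite -[X in _ --> m * (X + _)](mul0r l) -[X in _ --> m * (_ + X)](mulr0 c).
by apply: cvgMr; apply: cvgD; [exact: cvgM|exact: cvgMr].
Qed.

Section complex_limits.
Context {R : realType}.
Implicit Types (z : R[i]) (e : R).

Lemma norm_Re_le z : `|Re z|%:C <= `|z|.
Proof. exact: normc_ge_Re. Qed.

Lemma norm_Im_le z : `|Im z|%:C <= `|z|.
Proof.
by case: z => a b; simpc; rewrite -sqrtr_sqr ler_wsqrtr // lerDr sqr_ge0.
Qed.

Lemma norm_le_ReIm z : `|z| <= `|Re z|%:C + `|Im z|%:C.
Proof.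
rewrite [X in `|X| <= _](complexE z) (le_trans (ler_normD _ _))//.
by rewrite normrM [X in _ + X * _](_ : _ = 1) ?mul1r ?normc_def /= ?expr0n /=
  ?addr0 ?add0r ?expr1n ?sqrtr_sqr ?sqrtr1.
Qed.

Lemma ge0_complex z : 0 <= z -> exists2 e, 0 <= e & z = e%:C.
Proof. by case: z => a b; simpc => /andP[/eqP -> a0]; exists a. Qed.

Lemma gt0_complex z : 0 < z -> exists2 e, 0 < e & z = e%:C.
Proof. by case: z => a b; simpc => /andP[/eqP -> a0]; exists a. Qed.

Lemma conjcN z : (- z)^* = - z^*. Proof. exact: rmorphN. Qed.
Lemma conjcD z w : (z + w)^* = z^* + w^*. Proof. exact: rmorphD. Qed.
Lemma conjcM z w : (z * w)^* = z^* * w^*. Proof. exact: rmorphM. Qed.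

Context {T : Type} {F : set_system T}.
Context {FF : Filter F}.

Lemma cvg_Re (f : T -> R[i]^o) (z : R[i]^o) :
  f t @[t --> F] --> z -> Re (f t) @[t --> F] --> Re z.
Proof.
move=> /cvgrPdist_lt fz; apply/cvgrPdist_lt => e e0.
have e0C : 0 < e%:C by rewrite ltcR.
near=> t; rewrite -ltcR; apply: le_lt_trans (near (fz _ e0C) t _) => //.
by rewrite -raddfB norm_Re_le.
Unshelve. all: by end_near. Qed.

Lemma cvg_Im (f : T -> R[i]^o) (z : R[i]^o) :
  f t @[t --> F] --> z -> Im (f t) @[t --> F] --> Im z.
Proof.
move=> /cvgrPdist_lt fz; apply/cvgrPdist_lt => e e0.
have e0C : 0 < e%:C by rewrite ltcR.
near=> t; rewrite -ltcR; apply: le_lt_trans (near (fz _ e0C) t _) => //.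
by rewrite -raddfB norm_Im_le.
Unshelve. all: by end_near. Qed.

Lemma cvg_squeeze (V : normedModType R[i]) (f : T -> V) (l : V)
    (g : T -> R[i]^o) :
  (forall t, `|f t - l| <= g t) -> g t @[t --> F] --> (0 : R[i]^o) ->
  f t @[t --> F] --> l.
Proof.
move=> fg /cvgr0Pnorm_lt g0; apply/cvgrPdist_lt => e e0; near=> t.
rewrite distrC (le_lt_trans (fg t))// (le_lt_trans (real_ler_norm _))//.
  by rewrite ger0_real// (le_trans _ (fg t)).
by near: t; apply: g0.
Unshelve. all: by end_near. Qed.

End complex_limits.

Lemma cvg_ge0 (R : realType) (T : Type) (F : set_system T)
    (FF : ProperFilter F) (f : T -> R[i]^o) (z : R[i]^o) :
  f t @[t --> F] --> z -> (\forall t \near F, 0 <= f t) -> 0 <= z.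
Proof.
move=> fz f0; case: z fz => a b fz; simpc; apply/andP; split.
- have fb : Im (f t) @[t --> F] --> b by exact: cvg_Im fz.
  apply/eqP; rewrite -(cvg_lim _ fb)//; apply: (@cvg_lim R) => //.
  apply: cvg_near_cst; near=> t.
  by have /ge0_complex [e _ ->] : 0 <= f t by near: t.
- have fa : Re (f t) @[t --> F] --> a by exact: cvg_Re fz.
  rewrite -[a](cvg_lim _ fa)//; apply: limr_ge; first by apply/cvg_ex; exists a.
  near=> t; have /ge0_complex [e e0 ->] // : 0 <= f t by near: t.
Unshelve. all: by end_near. Qed.

(** * Inner products and the Riesz representation theorem *)

Section hilbert.
Context {R : realType}.
Implicit Types (H : hilbertType R).

(** The combinations (q, - z) and (- conj z, p) give the inequality when q or p
    is nonzero; for p = q = 0, the combination (- conj z, 1) forces z = 0. Only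
    the three values p, q, z of a form on two vectors enter, so that Hilbert
    spaces and formal combinations of points of a kernel are both covered. *)
Lemma psd2_cauchy_schwarz (p q z : R[i]) :
  (forall a b : R[i],
    0 <= a * a^* * p + a * b^* * z + b * a^* * z^* + b * b^* * q) ->
  [/\ 0 <= p, 0 <= q & `|z| ^+ 2 <= p * q].
Proof.
move=> psd.
have p0 : 0 <= p.
  by have := psd 1 0; rewrite !(conjc0, conjc1, mul0r, mulr0, mul1r, addr0).
have q0 : 0 <= q.
  by have := psd 0 1; rewrite !(conjc0, conjc1, mul0r, mulr0, mul1r, add0r).
split=> //; have [e e0 pE] := ge0_complex p0; have [d d0 qE] := ge0_complex q0.
have qJ : q^* = q by rewrite qE conjc_real.
have pJ : p^* = p by rewrite pE conjc_real.
rewrite sqr_normc.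
have [q_gt0|] := boolP (0 < q).
  rewrite -subr_ge0 -(pmulr_rge0 _ q_gt0).
  have := psd q (- z); rewrite conjcN qJ; congr (_ <= _); ring.
have [p_gt0 _|p_le0 q_le0] := boolP (0 < p).
  rewrite -subr_ge0 -(pmulr_rge0 _ p_gt0).
  have := psd (- z^*) p; rewrite conjcN conjcK pJ; congr (_ <= _); ring.
have p00 : p = 0 by apply/eqP; move: p0 p_le0;
  rewrite le_eqVlt eq_sym => /orP[->//|->].
have q00 : q = 0 by apply/eqP; move: q0 q_le0;
  rewrite le_eqVlt eq_sym => /orP[->//|->].
have := psd (- z^*) 1; rewrite conjcN conjcK conjc1 p00 q00 mul0r => h.
rewrite -(@pmulr_rle0 _ 2)// -oppr_ge0; move: h; congr (_ <= _); ring.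
Qed.

Section dot.
Context {H : hilbertType R}.
Implicit Types (x y z : H) (a : R[i]).

Lemma dotpDl x y z : dotp (x + y) z = dotp x z + dotp y z.
Proof. exact: linearDl. Qed.
Lemma dotpDr x y z : dotp z (x + y) = dotp z x + dotp z y.
Proof. exact: linearDr. Qed.
Lemma dotpBl x y z : dotp (x - y) z = dotp x z - dotp y z.
Proof. exact: linearBl. Qed.
Lemma dotpBr x y z : dotp z (x - y) = dotp z x - dotp z y.
Proof. exact: linearBr. Qed.
Lemma dotpZl a x z : dotp (a *: x) z = a * dotp x z.
Proof. exact: linearZl_LR. Qed.
Lemma dotpZr a x z : dotp z (a *: x) = a^* * dotp z x.
Proof. exact: linearZr_LR. Qed.
Lemma dotpJ x y : dotp x y = (dotp y x)^*.
Proof. by rewrite -[RHS]mul1r; exact: (hermC dotp x y). Qed.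
Lemma dotp_ge0 x : 0 <= dotp x x.
Proof. by rewrite -normE exprn_ge0. Qed.

Lemma dotp_cauchy_schwarz x y : `|dotp x y| <= `|x| * `|y|.
Proof.
rewrite -(@ler_pXn2r _ 2)// ?nnegrE ?mulr_ge0// exprMn !normE.
suff /psd2_cauchy_schwarz[] : forall a b : R[i], 0 <= a * a^* * dotp x x +
    a * b^* * dotp x y + b * a^* * (dotp x y)^* + b * b^* * dotp y y by [].
move=> a b; have := dotp_ge0 (a *: x + b *: y); congr (_ <= _).
by rewrite dotpDl !dotpDr !dotpZl !dotpZr -(dotpJ y x); ring.
Qed.

Lemma dotp_inj y z : (forall x, dotp x y = dotp x z) -> y = z.
Proof.
move=> yz; apply/eqP; rewrite -subr_eq0 -normr_eq0.
suff : `|y - z| ^+ 2 == 0 by rewrite expf_eq0.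
by rewrite normE dotpBr yz subrr.
Qed.

End dot.

(** At t = - b / (a + 1) the quadratic polynomial is
    - b ^ 2 (a + 2) / (a + 1) ^ 2; the shift of a by 1 includes the case
    a = 0. *)
Lemma quad_ge0_eq0 (a b : R) :
  (forall t, 0 <= t ^+ 2 * a + t * b *+ 2) -> b = 0.
Proof.
move=> h; have a0 : 0 <= a by have := h 1; have := h (- 1); lra.
have a1 : a + 1 != 0 by lra.
have := h (- b / (a + 1)).
have -> : (- b / (a + 1)) ^+ 2 * a + (- b / (a + 1)) * b *+ 2 =
   - (b ^+ 2 * ((a + 2) / (a + 1) ^+ 2)) by field.
rewrite oppr_ge0 pmulr_lle0; last by rewrite divr_gt0 ?exprn_gt0//; lra.
by rewrite real_exprn_even_le0 ?num_real// => /eqP.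
Qed.

Definition sqnorm H (x : H) : R := Re (dotp x x).

Lemma sqnormE H (x : H) : dotp x x = (sqnorm x)%:C.
Proof. by have /ge0_complex [e e0 E] := dotp_ge0 x; rewrite /sqnorm E. Qed.

Lemma Re_dotpC H (x y : H) : Re (dotp x y) = Re (dotp y x).
Proof. by rewrite dotpJ; case: (dotp y x). Qed.

Lemma sqnormD H (x y : H) : sqnorm (x + y) =
  sqnorm x + sqnorm y + Re (dotp x y) *+ 2.
Proof.
rewrite /sqnorm dotpDl !dotpDr !raddfD /= (Re_dotpC y x); ring.
Qed.

Lemma sqnormB H (x y : H) : sqnorm (x - y) =
  sqnorm x + sqnorm y - Re (dotp x y) *+ 2.
Proof.
rewrite /sqnorm dotpBl !dotpBr !raddfB /= (Re_dotpC y x); ring.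
Qed.

Lemma ReD (z w : R[i]) : Re (z + w) = Re z + Re w.
Proof. exact: raddfD. Qed.

Lemma ReZ (r : R) (z : R[i]) : Re (r%:C * z) = r * Re z.
Proof. by case: z => a b; simpc. Qed.

Lemma sqnormZ H (r : R) (x : H) : sqnorm (r%:C *: x) = r ^+ 2 * sqnorm x.
Proof. by rewrite /sqnorm dotpZl dotpZr conjc_real !ReZ mulrA. Qed.

Lemma cauchy_seq_cvg H (u : nat -> H) (c : nat -> R) :
  c n @[n --> \oo] --> 0 ->
  (forall n m, sqnorm (u n - u m) <= c n + c m) -> cvg (u n @[n --> \oo]).
Proof.
move=> c0 uc; apply/cauchy_cvgP/cauchyP => e /gt0_complex [d d0 ->].
have d20 : 0 < d ^+ 2 / 2 by rewrite divr_gt0// exprn_gt0.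
have /cvgrPdist_lt /(_ _ d20) [N _ cN] := c0.
exists (u N); exists N => // n Nn /=.
rewrite -ball_normE /= -(@ltr_pXn2r _ 2)// ?nnegrE// ?ler0c ?ltW//.
rewrite normE sqnormE -rmorphXn/= ltcR (le_lt_trans (uc _ _))//.
have := cN _ Nn; have := cN _ (leqnn N); rewrite !sub0r !normrN !ltr_norml.
by move=> /andP[_ cNd] /andP[_ cnd]; rewrite [ltRHS](splitr _) ltrD.
Qed.

Lemma cvg_sqnorm H (u : nat -> H) x :
  u n @[n --> \oo] --> x -> sqnorm (u n) @[n --> \oo] --> sqnorm x.
Proof.
move=> ux; suff: dotp (u n) (u n) @[n --> \oo] --> (dotp x x : R[i]^o).
  exact: cvg_Re.
under eq_fun do rewrite -normE; rewrite -normE !expr2.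
under eq_fun do rewrite expr2.
by apply: cvgM; apply: (@cvg_norm _ H).
Qed.

Lemma bounded_le (V W : normedModType R[i]) (f : V -> W) (M : R) :
  (forall x, `|f x| <= M%:C * `|x|) ->
  exists2 N : R, 0 < N & forall x, `|f x| <= N%:C * `|x|.
Proof.
move=> fM; exists (`|M| + 1) => [|x]; first by rewrite ltr_wpDl.
rewrite (le_trans (fM x))// ler_wpM2r// lecR (le_trans (ler_norm M))//.
by rewrite lerDl.
Qed.

Lemma bounded_cvg (V W : normedModType R[i]) (f : V -> W) (M : R)
   (T : Type) (F : set_system T) (FF : Filter F) (u : T -> V) x :
  (forall x y, f (x - y) = f x - f y) ->
  (forall x, `|f x| <= M%:C * `|x|) ->
  u t @[t --> F] --> x -> f (u t) @[t --> F] --> f x.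
Proof.
move=> fB /bounded_le [N N0 fN] /cvgrPdist_lt ux; apply/cvgrPdist_lt => e e0.
have NC0 : 0 < N%:C by rewrite ltcR.
have eN : 0 < e / N%:C by rewrite divr_gt0.
near=> t; rewrite -fB (le_lt_trans (fN _))// mulrC -ltr_pdivlMr//.
by near: t; exact: ux.
Unshelve. all: by end_near. Qed.

(** The representing vector minimizes g x = |x| ^ 2 - 2 Re (f x). By the
    parallelogram identity a minimizing sequence is a Cauchy sequence. At a
    minimizer z, the inequality g z <= g (z + t x) for all real t says that
    Re (f x) = Re <x, z>, and replacing x by i x gives the imaginary parts. *)
Lemma riesz H (f : H -> R[i]) (M : R) :
  (forall a x y, f (a *: x + y) = a * f x + f y) ->
  (forall x, `|f x| <= M%:C * `|x|) ->
  exists z, forall x, f x = dotp x z.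
Proof.
move=> flin fM0; have [N N0 fN] := @bounded_le H R[i]^o f M fM0.
have fD x y : f (x + y) = f x + f y by rewrite -[x]scale1r flin mul1r scale1r.
have f0 : f 0 = 0 by apply: (addrI (f 0)); rewrite -fD !addr0.
have fZ a x : f (a *: x) = a * f x by rewrite -[a *: x]addr0 flin f0 addr0.
have fB x y : f (x - y) = f x - f y by rewrite fD -scaleN1r fZ mulN1r.
pose g x := sqnorm x - Re (f x) *+ 2.
have g_lb x : - N ^+ 2 <= g x.
  have nx0 : 0 <= `|x| by [].
  have [n n0 xn] := ge0_complex nx0.
  have sx : sqnorm x = n ^+ 2 by rewrite /sqnorm -normE xn -rmorphXn.
  have fx : Re (f x) <= N * n.
    rewrite -lecR; apply: le_trans (_ : `|Re (f x)|%:C <= _);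
      first by rewrite lecR ler_norm.
    by rewrite (le_trans (norm_Re_le _))// (le_trans (fN x))// xn -rmorphM.
  rewrite /g sx; have := sqr_ge0 (n - N); rewrite sqrrB; lra.
have g_inf : has_inf [set g x | x in [set: H]].
  by split; [exists (g 0); exists 0|exists (- N ^+ 2) => _ [x _ <-]].
set m := inf [set g x | x in [set: H]].
have mg x : m <= g x by apply: ge_inf; [exact: g_inf.2|exists x].
have /choice [u uP] : forall n : nat, exists x, g x < m + n.+1%:R^-1.
  move=> n; have e0 : 0 < n.+1%:R^-1 :> R by rewrite invr_gt0.
  by have [_ [x _ <-] gx] := inf_adherent e0 g_inf; exists x.
have u_cvg : cvg (u n @[n --> \oo]).
  apply: (@cauchy_seq_cvg _ _ (fun n => n.+1%:R^-1 *+ 2)).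
    rewrite -[0 in X in _ --> X](mul0rn _ 2).
    by apply: cvgMn; exact: cvg_harmonic.
  (* The value of g at the midpoint of u n and u k is at least m. *)
  move=> n k; have := uP n; have := uP k; have := mg ((2^-1)%:C *: (u n + u k)).
  rewrite /g sqnormZ fZ ReZ fD ReD sqnormD sqnormB.
  have -> : 2^-1 ^+ 2 = 4^-1 :> R by rewrite exprVn -natrX.
  move: (n.+1%:R^-1) (k.+1%:R^-1) => a b.
  move: (sqnorm _) (sqnorm _) (Re _) (Re _) (Re _) => p q d e e'.
  move=> h1 h2 h3; lra.
pose z := lim (u n @[n --> \oo]).
have uz : u n @[n --> \oo] --> z by [].
have gz : g z = m.
  have gu : g (u n) @[n --> \oo] --> g z.
    apply: cvgB; first exact: cvg_sqnorm.
    by apply: cvgMn; apply: cvg_Re; apply: (@bounded_cvg H R[i]^o f N).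
  have : m + n.+1%:R^-1 @[n --> \oo] --> m.
    by rewrite -[m in X in _ --> X]addr0; apply: cvgD;
      [exact: cvg_cst|exact: cvg_harmonic].
  move=> mn; apply/eqP; rewrite eq_le mg andbT.
  by apply: ler_cvg_to gu mn _; apply: nearW => n; rewrite ltW.
have ReE x : Re (f x) = Re (dotp x z).
  apply/esym/subr0_eq; apply: (@quad_ge0_eq0 (sqnorm x)) => t.
  have := mg (z + t%:C *: x); rewrite -gz /g sqnormD sqnormZ fD ReD fZ ReZ.
  by rewrite dotpZr conjc_real ReZ Re_dotpC; lra.
exists z => x; apply/eqP; rewrite eq_complex ReE eqxx /=.
have := ReE ('i *: x); rewrite fZ dotpZl.
by case: (f x) (dotp x z) => a b [c d]; simpc => /eqP; rewrite eqr_opp.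
Qed.

End hilbert.

(** * Adjoints and bounded sesquilinear forms *)

Section operators.
Context {R : realType}.
Implicit Types H : hilbertType R.

(** The functional x |-> <f x, y> is bounded, hence represented by a vector. *)
Lemma adjointP H H' (f : H -> H') : bounded_op f ->
  forall x y, dotp (f x) y = dotp x (adjoint f y).
Proof.
move=> [flin [M fM]] x y; rewrite /adjoint; case: xgetP => [z _ //|] /=.
have [n n0 nE] : exists2 n, 0 <= n & `|y| = n%:C by apply: ge0_complex.
have [||z zP] := @riesz R H (fun x => dotp (f x) y) (M * n).
- by move=> a u v; rewrite flin dotpDl dotpZl.
- move=> u; rewrite (le_trans (dotp_cauchy_schwarz _ _))// nE rmorphM /= mulrAC.
  by rewrite ler_wpM2r// ler0c.
by move=> /(_ z) /(_ zP).
Qed.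

Lemma adjoint_eq H H' (f : H -> H') y z :
  (forall x, dotp (f x) y = dotp x z) -> adjoint f y = z.
Proof.
move=> fz; rewrite /adjoint; case: xgetP => [w _ wP|/(_ z)/(_ fz)//].
by apply: dotp_inj => x; rewrite -wP fz.
Qed.

Section bounded_op.
Context {H H' : hilbertType R} (f : H -> H') (fbd : bounded_op f).

Lemma bounded_opB x y : f (x - y) = f x - f y.
Proof. by case: fbd => flin _; rewrite addrC -scaleN1r flin scaleN1r addrC. Qed.

Lemma bounded_op0 : f 0 = 0.
Proof. by rewrite -[0](subrr 0) bounded_opB subrr. Qed.

Lemma bounded_op_opp x : f (- x) = - f x.
Proof. by rewrite -sub0r bounded_opB bounded_op0 sub0r. Qed.

Lemma bounded_opZ a x : f (a *: x) = a *: f x.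
Proof.
by case: fbd => flin _; rewrite -[a *: x]addr0 flin bounded_op0 addr0.
Qed.

Lemma bounded_op_cvg (S : Type) (F : set_system S) (FF : Filter F)
  (u : S -> H) x : u t @[t --> F] --> x -> f (u t) @[t --> F] --> f x.
Proof. by case: fbd => _ [M fM]; apply: bounded_cvg fM; exact: bounded_opB. Qed.

End bounded_op.

Lemma bounded_op_id H : bounded_op (@idfun H).
Proof. by split=> [//|]; exists 1 => x; rewrite mul1r. Qed.

Lemma bounded_op_comp H H' H'' (f : H' -> H'') (g : H -> H') :
  bounded_op f -> bounded_op g -> bounded_op (f \o g).
Proof.
move=> [flin [M /bounded_le [m m0 fM]]] [glin [N gN]]; split.
  by move=> a x y /=; rewrite glin flin.
exists (m * N) => x /=; rewrite (le_trans (fM _))// rmorphM/= -mulrA.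
by rewrite ler_wpM2l// ler0c ltW.
Qed.

Lemma bounded_opN H H' (f : H -> H') : bounded_op f -> bounded_op (- f).
Proof.
move=> [flin [M fM]]; split.
  by move=> a x y /=; rewrite /GRing.opp/= flin opprD scalerN.
by exists M => x; rewrite normrN.
Qed.

End operators.

Section forms.
Context {R : realType} {H : hilbertType R}.
Implicit Types (Q : H -> H -> R[i]) (A B : H -> H).

Definition bounded_form Q :=
  [/\ forall a x y z, Q (a *: x + y) z = a * Q x z + Q y z,
      forall a x y z, Q z (a *: x + y) = a^* * Q z x + Q z y
    & exists M : R, forall x y, `|Q x y| <= M%:C * (`|x| * `|y|)].

Definition positive_form Q := forall x, 0 <= Q x x.

(** For Q (x, y) = <X x, y>, this is the form of X - B^* X B. Starting from the
    inner product, composing it over B = T_i(t_i) for i in K yields the Brehmer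
    operator, the alternating sum of the T_C(t)^* T_C(t) over the subsets C of
    K. *)
Definition decrease B Q : H -> H -> R[i] :=
  fun x y => Q x y - Q (B x) (B y).

(** For Q (x, y) = <X x, y>, this is the form of - A^* X - X A, which is minus
    the derivative at 0 of exp(t A)^* X exp(t A). *)
Definition dissipation A Q : H -> H -> R[i] :=
  fun x y => - (Q (A x) y + Q x (A y)).

Lemma bounded_form_dotp : bounded_form (dotp : H -> H -> R[i]).
Proof.
split=> [a x y z|a x y z|]; first by rewrite dotpDl dotpZl.
  by rewrite dotpDr dotpZr.
by exists 1 => x y; rewrite mul1r dotp_cauchy_schwarz.
Qed.

Section bounded_form.
Context (Q : H -> H -> R[i]) (Qbd : bounded_form Q).

Lemma sesqDl x y z : Q (x + y) z = Q x z + Q y z.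
Proof. by case: Qbd => Ql _ _; rewrite -[x]scale1r Ql mul1r scale1r. Qed.
Lemma sesqDr x y z : Q z (x + y) = Q z x + Q z y.
Proof. by case: Qbd => _ Ql _; rewrite -[x]scale1r Ql conjc1 mul1r scale1r. Qed.
Lemma sesq0l z : Q 0 z = 0.
Proof. by apply: (addrI (Q 0 z)); rewrite -sesqDl !addr0. Qed.
Lemma sesq0r z : Q z 0 = 0.
Proof. by apply: (addrI (Q z 0)); rewrite -sesqDr !addr0. Qed.
Lemma sesqZl a x z : Q (a *: x) z = a * Q x z.
Proof. by case: Qbd => Ql _ _; rewrite -[a *: x]addr0 Ql sesq0l addr0. Qed.
Lemma sesqZr a x z : Q z (a *: x) = a^* * Q z x.
Proof. by case: Qbd => _ Ql _; rewrite -[a *: x]addr0 Ql sesq0r addr0. Qed.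
Lemma sesqBl x y z : Q (x - y) z = Q x z - Q y z.
Proof. by rewrite sesqDl -scaleN1r sesqZl mulN1r. Qed.
Lemma sesqBr x y z : Q z (x - y) = Q z x - Q z y.
Proof. by rewrite sesqDr -scaleN1r sesqZr conjcN conjc1 mulN1r. Qed.

Lemma sesqNl x z : Q (- x) z = - Q x z.
Proof. by rewrite -scaleN1r sesqZl mulN1r. Qed.
Lemma sesqNr x z : Q z (- x) = - Q z x.
Proof. by rewrite -scaleN1r sesqZr conjcN conjc1 mulN1r. Qed.

Lemma bounded_form_comp A B : bounded_op A -> bounded_op B ->
  bounded_form (fun x y => Q (A x) (B y)).
Proof.
move=> [Al [M /bounded_le[m m0 AM]]] [Bl [N /bounded_le[n n0 BN]]].
case: Qbd => Ql Qr [q Qq]; split=> [a x y z|a x y z|]; rewrite ?Al ?Bl//.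
exists (`|q| * (m * n)) => x y; rewrite (le_trans (Qq _ _))//.
rewrite (@le_trans _ _ (`|q|%:C * (`|A x| * `|B y|)))//.
  by rewrite ler_wpM2r ?mulr_ge0// lecR ler_norm.
rewrite [(`|q| * _)%:C]rmorphM/= -mulrA ler_wpM2l ?ler0c//.
by rewrite rmorphM/= mulrACA ler_pM.
Qed.

Lemma form_cvg (S : Type) (F : set_system S) (FF : Filter F) (u v : S -> H)
    x y :
  u t @[t --> F] --> x -> v t @[t --> F] --> y ->
  Q (u t) (v t) @[t --> F] --> (Q x y : R[i]^o).
Proof.
move=> ux vy; have [_ _ [M QM]] := Qbd.
apply: (@cvg_squeeze R S F FF R[i]^o _ _ (fun t => (M%:C : R[i]^o) *
   (`|u t - x| * `|v t| + `|x| * `|v t - y|))) => [t|].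
  have -> : Q (u t) (v t) - Q x y = Q (u t - x) (v t) + Q x (v t - y).
    by rewrite sesqBl sesqBr addrA subrK.
  by rewrite (le_trans (ler_normD _ _))// mulrDr lerD.
have ux0 : `|u t - x| @[t --> F] --> (0 : R[i]^o).
  by rewrite -(@normr0 _ H); apply: (@cvg_norm _ H); exact/subr_cvg0.
have vy0 : `|v t - y| @[t --> F] --> (0 : R[i]^o).
  by rewrite -(@normr0 _ H); apply: (@cvg_norm _ H); exact/subr_cvg0.
have vn : `|v t| @[t --> F] --> (`|y| : R[i]^o) by apply: (@cvg_norm _ H).
exact: cvg0_bilinear ux0 vn vy0.
Qed.

End bounded_form.
End forms.

Section form_closure.
Context {R : realType} {H : hilbertType R}.
Implicit Types (Q : H -> H -> R[i]) (A B : H -> H).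

Lemma bounded_formD Q Q' : bounded_form Q -> bounded_form Q' ->
  bounded_form (fun x y => Q x y + Q' x y).
Proof.
move=> [Ql Qr [M QM]] [Ql' Qr' [N QN]]; split=> [a x y z|a x y z|].
- by rewrite Ql Ql' mulrDr addrACA.
- by rewrite Qr Qr' mulrDr addrACA.
exists (M + N) => x y; rewrite (le_trans (ler_normD _ _))//.
by rewrite rmorphD/= mulrDl lerD.
Qed.

Lemma bounded_formN Q : bounded_form Q -> bounded_form (fun x y => - Q x y).
Proof.
move=> [Ql Qr [M QM]]; split=> [a x y z|a x y z|].
- by rewrite Ql opprD mulrN.
- by rewrite Qr opprD mulrN.
by exists M => x y; rewrite normrN.
Qed.

Lemma bounded_form_decrease B Q :
  bounded_op B -> bounded_form Q -> bounded_form (decrease B Q).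
Proof.
by move=> Bb Qb; apply: bounded_formD => //; apply: bounded_formN;
  apply: bounded_form_comp.
Qed.

Lemma bounded_form_dissipation A Q :
  bounded_op A -> bounded_form Q -> bounded_form (dissipation A Q).
Proof.
by move=> Ab Qb; apply: bounded_formN; apply: bounded_formD;
  apply: (bounded_form_comp Qb) => //; exact: bounded_op_id.
Qed.

End form_closure.

(** * Semigroups with a bounded generator *)

(** Let e > 0 and let c be the supremum of the s in [0, t] such that
    F s <= F 0 + e s. By continuity c is such an s, and if c < t, the right
    derivative at c, which is less than e, yields larger ones. *)
Lemma right_derivative_le0_nonincreasing (R : realType) (F : R -> R) :
  (forall s : R, 0 <= s -> F t @[t --> within [set u | 0 <= u] (nbhs s)] -->
    F s) ->
  (forall s : R, 0 <= s -> exists2 d : R, d <= 0 &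
     h^-1 * (F (s + h) - F s) @[h --> (0 : R)^'+] --> d) ->
  forall t : R, 0 <= t -> F t <= F 0.
Proof.
move=> Fc Fd t t0; suff H (e : R) : 0 < e -> F t <= F 0 + e * t.
  apply/ler_addgt0Pr => e e0; rewrite (le_trans (H (e / (t + 1)) _))//.
    by rewrite divr_gt0//; lra.
  by rewrite lerD2l mulrAC ler_pdivrMr ?ler_pM2l//; lra.
move=> e0; pose S := [set s | 0 <= s <= t /\ F s <= F 0 + e * s].
have S0 : S 0 by split; [rewrite lexx|rewrite mulr0 addr0].
have Sub : has_ubound S by exists t => s [/andP[_ ?] _].
pose c := sup S.
have c0 : 0 <= c by apply: ub_le_sup.
have ct : c <= t by apply: ge_sup; [exists 0|move=> s [/andP[]]].
have Sc : F c <= F 0 + e * c.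
  rewrite leNgt; apply/negP => ltF.
  have Fec : F s - e * s @[s --> within [set u | 0 <= u] (nbhs c)] -->
    F c - e * c.
    apply: cvgB; first exact: Fc.
    by apply: cvgMr; apply: cvg_within_filter; exact: cvg_id.
  have ltF' : F 0 < F c - e * c by rewrite ltrBrDr.
  have [d /= d0 dF] : \forall s \near within [set u | 0 <= u] (nbhs c),
    F 0 < F s - e * s.
    exact: (cvgr_gt _ Fec).
  have [|s [/andP[s0 st] Fs] cds] := @sup_adherent _ S d d0; first by split;
    [exists 0|].
  have sc : s <= c by apply: ub_le_sup => //; split => //; rewrite s0.
  have := dF s; rewrite /= ger0_norm ?subr_ge0//.
  move=> /(_ _ s0); rewrite ltrBlDl -ltrBlDr => /(_ cds).
  by rewrite ltNge lerBlDr Fs.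
have [<-//|ltct] := eqVneq c t.
have {}ltct : c < t by rewrite lt_neqAle ltct.
have [d d0 cd] := Fd c c0.
exfalso; have cde : \forall h \near (0 : R)^'+, h^-1 * (F (c + h) - F c) < e.
  by apply: (cvgr_lt _ cd); exact: le_lt_trans e0.
near (0 : R)^'+ => h.
have h0 : 0 < h by near: h; exact: nbhs_right_gt.
have ht : h <= t - c by near: h; apply: nbhs_right_le; rewrite subr_gt0.
have Fch : F (c + h) - F c < e * h
  by rewrite mulrC -ltr_pdivrMl//; near: h.
have : S (c + h).
  by split; [rewrite addr_ge0//=; lra|rewrite mulrDr; lra].
by move=> /(ub_le_sup Sub); rewrite -/c; lra.
Unshelve. all: by end_near. Qed.

Section generator.
Context {R : realType} {H : hilbertType R}.
Context (T : R -> H -> H) (A : H -> H).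
Hypothesis T_semigroup : C0_semigroup T.
Hypothesis A_generator : bounded_generator T A.
Implicit Types (Q : H -> H -> R[i]) (x y : H).

Lemma semigroup_cvg x (s : R) : 0 <= s ->
  T t x @[t --> within [set u | 0 <= u] (nbhs s)] --> T s x.
Proof.
move=> s0; case: T_semigroup => _ _ _ /(_ x) /subspace_continuousP; exact.
Qed.

Lemma semigroup_cvg0 x : T t x @[t --> (0 : R)^'+] --> x.
Proof.
have T0 : T 0 x = x by case: T_semigroup => _ -> _ _.
have := @semigroup_cvg x 0 (lexx 0); rewrite T0; apply: cvg_trans.
move=> /= P [d d0 dP]; exists d => //= t td t0; apply: dP => //=.
by rewrite ltW.
Qed.

(** The product rule for the form Q at time 0. Since Q is jointly continuous,
    the strong derivative at 0 of the semigroup is enough, without any uniform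
    estimate. *)
Lemma decrease_quotient_cvg Q x y : bounded_form Q ->
  (h^-1)%:C * decrease (T h) Q x y @[h --> (0 : R)^'+] -->
    (dissipation A Q x y : R[i]^o).
Proof.
move=> Qb; have [Ab Ag] := A_generator.
have -> : (fun h => (h^-1)%:C * decrease (T h) Q x y) =
   (fun h => - (Q ((h^-1)%:C *: (T h x - x)) (T h y) +
                Q x ((h^-1)%:C *: (T h y - y)))).
  apply/funext => h; rewrite (sesqZl Qb) (sesqZr Qb) conjc_real.
  by rewrite (sesqBl Qb) (sesqBr Qb) /decrease; ring.
apply: cvg_oppD; apply: form_cvg => //.
- exact: semigroup_cvg0.
- exact: cvg_cst.
Qed.

(** The function s |-> Q (T s x, T s x) has the right derivative
    - dissipation A Q (T s x) (T s x) <= 0, hence decreases. *)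
Lemma decrease_ge0 Q t : bounded_form Q -> positive_form Q ->
  positive_form (dissipation A Q) -> 0 <= t -> positive_form (decrease (T t) Q).
Proof.
move=> Qb Q0 LQ0 t0 x; rewrite /decrease.
have [Tb T0 TD _] := T_semigroup.
pose F s := Re (Q (T s x) (T s x)).
have QE s : Q (T s x) (T s x) = (F s)%:C.
  by have /ge0_complex [e e0 E] := Q0 (T s x); rewrite /F E.
have -> : Q x x = (F 0)%:C by rewrite -QE T0.
rewrite QE subr_ge0 lecR.
apply: right_derivative_le0_nonincreasing t0 => s s0.
  by apply: cvg_Re; apply: form_cvg => //; exact: semigroup_cvg.
exists (- Re (dissipation A Q (T s x) (T s x))).
  by have := LQ0 (T s x); case: (dissipation _ _ _ _) => a b; simpc => /andP[_];
    rewrite oppr_le0.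
have /cvg_Re dQ := @decrease_quotient_cvg Q (T s x) (T s x) Qb.
apply: cvg_trans (cvgN dQ); apply: near_eq_cvg; near=> h.
have h0 : 0 <= h by near: h; exact: nbhs_right_ge.
transitivity (- (h^-1 * Re (decrease (T h) Q (T s x) (T s x)))).
  by rewrite -ReZ.
rewrite -mulrN /decrease; congr (_ * _).
have -> : T h (T s x) = T (s + h) x by rewrite [s + h]addrC TD.
by rewrite !QE -rmorphB /= opprB addrC.
Unshelve. all: by end_near. Qed.

(** Both sides applied to x are the limit of the vectors
    B (h^-1 (T h x - x)). *)
Lemma generator_commute (B : H -> H) : bounded_op B ->
  (forall h, 0 <= h -> T h \o B = B \o T h) -> A \o B = B \o A.
Proof.
move=> Bb TB; apply/funext => x /=; have [_ Ag] := A_generator.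
suff AB : (h^-1)%:C *: (T h (B x) - B x) @[h --> (0 : R)^'+] --> B (A x).
  exact: (cvg_unique (@norm_hausdorff _ H) (Ag (B x)) AB).
have BA : B ((h^-1)%:C *: (T h x - x)) @[h --> (0 : R)^'+] --> B (A x).
  exact: bounded_op_cvg (Ag x).
apply: cvg_trans BA; apply: near_eq_cvg.
near=> h; rewrite (bounded_opZ Bb) (bounded_opB Bb).
have h0 : 0 <= h by near: h; exact: nbhs_right_ge.
by rewrite -[B (T h x)]/((B \o T h) x) -TB.
Unshelve. all: by end_near. Qed.

End generator.

(** * Compositions of commuting families *)

Section compose_seq.
Context {X : Type} {J : eqType}.
Implicit Types (s : seq J) (F : J -> X -> X) (B : X -> X).

(** In contrast to the enumeration of a finite type, a list lends itself to
    induction. The type X is arbitrary because families of operators on vectors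
    and of transformations of forms are both composed. *)
Definition compose_seq s F : X -> X := foldr (fun i f => F i \o f) idfun s.

Lemma eq_compose_seq s F F' :
  {in s, F =1 F'} -> compose_seq s F = compose_seq s F'.
Proof.
elim: s => //= i s IH FF; rewrite FF ?mem_head// IH// => j js.
by rewrite FF// inE js orbT.
Qed.

Lemma compose_seq_comm s F B : (forall i, i \in s -> F i \o B = B \o F i) ->
  compose_seq s F \o B = B \o compose_seq s F.
Proof.
elim: s => //= i s IH FB; rewrite -compA IH => [|j js].
  by rewrite compA FB ?mem_head.
by rewrite FB// inE js orbT.
Qed.

Lemma compose_seq_id s F : {in s, forall i, F i = idfun} ->
  compose_seq s F = idfun.
Proof.
elim: s => //= i s IH FB; rewrite FB ?mem_head// IH// => j js.
by rewrite FB// inE js orbT.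
Qed.

Lemma compose_seq_rem s F i : (forall j k, F j \o F k = F k \o F j) ->
  i \in s -> compose_seq s F = F i \o compose_seq (rem i s) F.
Proof.
move=> Fc; elim: s => //= j s IH; rewrite inE eq_sym.
case: eqVneq => [->//|ji /= /IH ->]; apply/funext => x /=.
by rewrite -[LHS]/((F j \o F i) _) Fc.
Qed.

(** The factors at the indices of both lists can be brought to the front one by
    one as all factors commute, and the others are trivial. *)
Lemma compose_seq_indep s s' F : (forall j k, F j \o F k = F k \o F j) ->
  uniq s -> uniq s' -> (forall i, i \in s -> i \notin s' -> F i = idfun) ->
  (forall i, i \in s' -> i \notin s -> F i = idfun) ->
  compose_seq s F = compose_seq s' F.
Proof.
move=> Fc; elim: s s' => [|i s IH] s' /=.
  by move=> _ _ _ Fs'; rewrite compose_seq_id// => i /Fs' ->.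
move=> /andP[is_ us] us' Fs Fs'; have [is'|is'] := boolP (i \in s').
  rewrite (compose_seq_rem Fc is') (IH (rem i s'))//; first exact: rem_uniq.
    move=> j js; rewrite mem_rem_uniq// inE negb_and negbK => /orP[/eqP ji|].
      by rewrite -ji js in is_.
    by apply: Fs; rewrite inE js orbT.
  move=> j; rewrite mem_rem_uniq// inE => /andP[ji js'] js.
  by apply: Fs' => //; rewrite inE negb_or ji.
rewrite Fs ?mem_head// (IH s')// => j js.
  by apply: Fs; rewrite inE js orbT.
move=> js'; apply: Fs' => //; rewrite inE negb_or js' andbT.
by apply: contraNneq is' => <-.
Qed.

(** This adds a component to a family of times which vanishes at i. *)
Lemma compose_seq_update s F F' i : uniq s -> i \in s -> F i = idfun ->
  {in s, forall j, j != i -> F' j = F j} ->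
  {in s, forall j, F' i \o F j = F j \o F' i} ->
  compose_seq s F' = F' i \o compose_seq s F.
Proof.
elim: s => //= j s IH /andP[js us]; rewrite inE => /orP[/eqP -> Fj FF' _|].
  rewrite Fj (_ : compose_seq s F' = compose_seq s F)//.
  apply: eq_compose_seq => k ks; rewrite FF'// ?inE ?ks ?orbT//.
  by apply: contraNneq js => <-.
move=> is_ Fi FF' Fc; rewrite IH//.
- rewrite FF' ?mem_head//; last by apply: contraNneq js => ->.
  apply/funext => x /=; rewrite -[RHS]/((F' i \o F j) _) Fc ?mem_head//.
- by move=> k ks ki; rewrite FF'// inE ks orbT.
- by move=> k ks; rewrite Fc// inE ks orbT.
Qed.

End compose_seq.

Lemma compose_seq_map (X : Type) (I J : eqType) (f : J -> I) (F : I -> X -> X)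
    (s : seq J) :
  compose_seq [seq f i | i <- s] F = compose_seq s (F \o f).
Proof. by elim: s => //= i s ->. Qed.

Section fset_enumeration.
Context {I : choiceType}.

Lemma uniq_val_index_enum (K : {fset I}) :
  uniq [seq val i | i <- index_enum K].
Proof. by rewrite map_inj_uniq ?index_enum_uniq//; exact: val_inj. Qed.

Lemma mem_val_index_enum (K : {fset I}) i :
  (i \in [seq val j | j <- index_enum K]) = (i \in K).
Proof.
apply/mapP/idP => [[j _ ->]|iK]; first exact: valP.
by exists [` iK]%fset; rewrite ?mem_index_enum.
Qed.

End fset_enumeration.

Section bounded_compose.
Context {R : realType} {H : hilbertType R} {J : eqType}.

Lemma bounded_compose_seq (s : seq J) (F : J -> H -> H) :
  {in s, forall i, bounded_op (F i)} -> bounded_op (compose_seq s F).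
Proof.
elim: s => [_|i s IH Fb] /=; first exact: bounded_op_id.
apply: bounded_op_comp; first by apply: Fb; rewrite mem_head.
by apply: IH => j js; apply: Fb; rewrite inE js orbT.
Qed.

Lemma prod_op_compose_seq (K : finType) (P : {pred K}) (F : K -> H -> H) :
  prod_op P F = compose_seq (index_enum K)
    (fun j => if P j then F j else idfun).
Proof.
rewrite /prod_op; elim: (index_enum K) => [|j r IH].
  by rewrite big_nil.
by rewrite big_cons /= IH; case: (P j).
Qed.

End bounded_compose.

(** * Complete dissipativity as positivity of forms *)

Section dissipation_seq.
Context {R : realType} {H : hilbertType R}.
Implicit Types (Q : H -> H -> R[i]).

Definition dissipation_seq (J : eqType) (A : J -> H -> H) (s : seq J) :=
  compose_seq s (fun i => dissipation (A i)).

Lemma bounded_dissipation_seq (J : eqType) (A : J -> H -> H) s Q :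
  (forall i, bounded_op (A i)) -> bounded_form Q ->
  bounded_form (dissipation_seq A s Q).
Proof.
by move=> Ab Qb; elim: s => //= i s IH; apply: bounded_form_dissipation.
Qed.

Lemma dissipation_comm (A B : H -> H) : A \o B = B \o A ->
  dissipation A \o dissipation B = dissipation B \o dissipation A.
Proof.
move=> AB; apply/funext => Q; apply/funext => x; apply/funext => y.
have ABx z : A (B z) = B (A z) by rewrite -[LHS]/((A \o B) z) AB.
by rewrite /= /dissipation !ABx; ring.
Qed.

(** Each index of s contributes - A i either to the left or to the right
    argument of Q; the set C collects the indices that act on the right. *)
Lemma dissipation_seq_sum (J : finType) (A : J -> H -> H) (s : seq J) Q x y :
  (forall i, bounded_op (A i)) -> (forall i j, A i \o A j = A j \o A i) ->
  bounded_form Q -> uniq s ->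
  dissipation_seq A s Q x y = \sum_(C : {set J} | C \subset s)
    Q (compose_seq s (fun j => if j \notin C then - A j else idfun) x)
      (compose_seq s (fun j => if j \in C then - A j else idfun) y).
Proof.
move=> Ab Ac Qb; elim: s x y => [|i s IH] x y /=.
  move=> _; rewrite (big_pred1 finset.set0)// => C /=.
  apply/idP/eqP => [/fintype.subsetP C0|->]; last by apply/fintype.subsetP => j;
    rewrite inE.
  by apply/finset.setP => j; rewrite inE; apply/negP => /C0.
move=> /andP[is_ us]; rewrite /dissipation !IH// opprD.
have AAC (B : {pred J}) z : compose_seq s
  (fun j => if B j then - A j else idfun)
    (A i z) = A i (compose_seq s (fun j => if B j then - A j else idfun) z).
  have AC : compose_seq s (fun j => if B j then - A j else idfun) \o A i =
      A i \o compose_seq s (fun j => if B j then - A j else idfun).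
    apply: compose_seq_comm => j _; case: (B j) => //; apply/funext => u /=.
    rewrite -[(- A j) (A i u)]/(- (A j (A i u))) -[(- A j) u]/(- A j u).
    by rewrite (bounded_op_opp (Ab i)) -[A j (A i u)]/((A j \o A i) u) Ac.
  exact: (congr1 (fun f => f z) AC).
(* The sets that contain i correspond to the second term of the dissipation. *)
rewrite [RHS](bigID (fun C : {set J} => i \in C))/= addrC.
apply: f_equal2; rewrite -sumrN; last first.
  rewrite [RHS](reindex_onto (fun D => i |: D) (fun C => C :\ i)); last first.
    move=> C /andP[_ iC]; rewrite finset.setD1K//.
  apply: eq_big => C; [apply/idP/idP => [Cs|/andP[/andP[CU _] /eqP CE]]|].
  - have iC : i \notin C by apply: contra is_; exact: (fintype.subsetP Cs).
    rewrite finset.setU1K// eqxx finset.setU11 !andbT.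
    apply/fintype.subsetP => j; rewrite finset.in_setU1 inE => /orP[->//|jC].
    by rewrite (fintype.subsetP Cs)// orbT.
  - apply/fintype.subsetP => j jC; have :=
    fintype.subsetP CU j (finset.setU1r i jC).
    rewrite inE => /orP[/eqP ji|//]; move: jC.
    by rewrite -CE ji finset.in_setD1 eqxx.
  move=> Cs; rewrite AAC finset.in_setU1 eqxx/= -(sesqNr Qb).
  have iU j : j \in s -> (j \in i |: C) = (j \in C).
    by rewrite finset.in_setU1; case: eqVneq => [->|//]; rewrite (negPf is_).
  by congr Q; [|congr (- A i _)]; apply: (congr1 (fun f => f _));
    apply: eq_compose_seq => j js; rewrite iU.
apply: eq_big => C.
  apply/idP/andP => [Cs|[Cs iC]].
    split; last by apply: contra is_; exact: (fintype.subsetP Cs).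
    by apply/fintype.subsetP => j jC; rewrite inE (fintype.subsetP Cs)// orbT.
  apply/fintype.subsetP => j jC; have := fintype.subsetP Cs _ jC.
  by rewrite inE => /orP[/eqP ji|//]; rewrite -ji jC in iC.
move=> Cs; rewrite (AAC (fun j => j \notin C)).
have -> : i \in C = false.
  by apply/negP => /(fintype.subsetP Cs); rewrite (negPf is_).
by rewrite -(sesqNl Qb).
Qed.

End dissipation_seq.

Section complete_dissipativity.
Context {R : realType} {H : hilbertType R} {I : choiceType}.
Context (A : I -> H -> H).
Hypothesis A_bounded : forall i, bounded_op (A i).
Hypothesis A_commute : forall i j, A i \o A j = A j \o A i.

(** A pair of complementary sets is determined by its first component, which
    plays the role of C in the expansion of the iterated dissipation. *)
Lemma dissipation_opE (K : {fset I}) x :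
  dotp (dissipation_op A K x) x =
    2 ^- #|` K| * dissipation_seq (A \o val) (index_enum K) dotp x x.
Proof.
rewrite [dissipation_op A K x]/(2 ^- #|` K| *:
  (\sum_(C : {set K} * {set K} | _) _) x).
rewrite dotpZl fct_sumE linear_sumlz; congr (_ * _).
rewrite dissipation_seq_sum//; last 4 first.
- by move=> i; exact: A_bounded.
- by move=> i j; exact: A_commute.
- exact: bounded_form_dotp.
- exact: index_enum_uniq.
rewrite (reindex_onto (fun C : {set K} => (C, ~: C)) (fun C => C.1)) /=;
  last first.
  move=> [C D] /= /andP[CD /eqP CDT]; congr pair; apply/finset.setP => i.
  rewrite finset.in_setC; have : i \in C :|: D by rewrite CDT finset.in_setT.
  rewrite finset.in_setU; case: (boolP (i \in C)) => //= iC _.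
  by rewrite (disjointFr CD iC).
apply: eq_big => C.
  rewrite eqxx andbT finset.setUCr eqxx andbT.
  rewrite -finset.setI_eq0 finset.setICr eqxx.
  by apply/esym/fintype.subsetP => j _; rewrite mem_index_enum.
move=> _; rewrite dotpJ -adjointP; last first.
  rewrite prod_op_compose_seq; apply: bounded_compose_seq => j _.
  by case: ifP => _; [exact: bounded_opN|exact: bounded_op_id].
rewrite -dotpJ !prod_op_compose_seq.
have -> : compose_seq (index_enum K)
    (fun j => if j \in ~: C then - A (val j) else idfun) =
  compose_seq (index_enum K) (fun j => if j \notin C then - A (val j) else
    idfun).
  by apply: eq_compose_seq => j _; rewrite finset.in_setC.
by [].
Qed.

Lemma dissipation_seq_indep (s s' : seq I) Q : uniq s -> uniq s' -> s =i s' ->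
  dissipation_seq A s Q = dissipation_seq A s' Q.
Proof.
move=> us us' ss'; congr (_ Q); apply: compose_seq_indep => //.
- by move=> i j; exact: dissipation_comm.
- by move=> i; rewrite ss' => ->.
- by move=> i; rewrite ss' => ->.
Qed.

Lemma completely_dissipativeP : completely_dissipative A <->
  forall s : seq I, uniq s -> positive_form (dissipation_seq A s dotp).
Proof.
have mapK (K : {fset I}) : dissipation_seq (A \o val) (index_enum K) dotp =
    dissipation_seq A [seq val i | i <- index_enum K] dotp.
  by rewrite /dissipation_seq compose_seq_map.
split=> [Apos s us x|Apos K x]; last first.
  by rewrite dissipation_opE mulr_ge0 ?invr_ge0 ?exprn_ge0// mapK;
    exact: (Apos _ (uniq_val_index_enum K)).
pose K := [fset i in s]%fset.
have := Apos K x; rewrite dissipation_opE pmulr_rge0 ?invr_gt0 ?exprn_gt0//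
  mapK.
rewrite (dissipation_seq_indep _ (uniq_val_index_enum K) us)// => i.
by rewrite mem_val_index_enum inE.
Qed.

End complete_dissipativity.

(** * From a dilation to complete dissipativity *)

Section inverses.
Context {R : realType}.

Lemma adjointPl (H H' : hilbertType R) (f : H -> H') : bounded_op f ->
  forall x y, dotp (adjoint f y) x = dotp y (f x).
Proof. by move=> fb x y; rewrite dotpJ -adjointP// -dotpJ. Qed.

Lemma adjointB (H H' : hilbertType R) (f : H -> H') : bounded_op f ->
  forall x y, adjoint f (x - y) = adjoint f x - adjoint f y.
Proof.
by move=> fb x y; apply: adjoint_eq => z; rewrite !dotpBr -!adjointP.
Qed.

Lemma inverse_commute (X : Type) (f f' g : X -> X) :
  f' \o f = idfun -> f \o f' = idfun -> f \o g = g \o f -> f' \o g = g \o f'.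
Proof.
move=> f'f ff' fg; apply/funext => x /=.
have E z : f' (f z) = z by rewrite -[LHS]/((f' \o f) z) f'f.
have E' z : f (f' z) = z by rewrite -[LHS]/((f \o f') z) ff'.
rewrite -[x in LHS]E' -[g (f _)]/((g \o f) _) -fg /= E//.
Qed.

Definition update (I : eqType) (Y : Type) (g : I -> Y) (i : I) (t : Y) :
    I -> Y :=
  fun j => if j == i then t else g j.

Lemma compose_seqB (V : zmodType) (J : eqType) (s : seq J) (F : J -> V -> V)
    x y :
  (forall i x y, F i (x - y) = F i x - F i y) ->
  compose_seq s F (x - y) = compose_seq s F x - compose_seq s F y.
Proof. by move=> FB; elim: s => //= i s ->; rewrite FB. Qed.

End inverses.

Section semigroup_seq.
Context {R : realType} {H : hilbertType R} {I : eqType}.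
Context (T : I -> R -> H -> H).
Hypothesis T_semigroup : forall i, C0_semigroup (T i).
Hypothesis T_commute : commuting T.
Implicit Types (s : seq I) (g : I -> R).

Definition positive_part g : I -> R := fun i => Num.max (g i) 0.

Definition semigroup_seq s g : H -> H :=
  compose_seq s (fun i => T i (positive_part g i)).

Lemma positive_part_ge0 g i : 0 <= positive_part g i.
Proof. by rewrite /positive_part le_max lexx orbT. Qed.

Lemma semigroup0 i : T i 0 = idfun.
Proof. by case: (T_semigroup i). Qed.

Lemma semigroup_bounded i t : 0 <= t -> bounded_op (T i t).
Proof. by case: (T_semigroup i) => Tb _ _ _; exact: Tb. Qed.

Lemma semigroup_seq_bounded s g : bounded_op (semigroup_seq s g).
Proof.
by apply: bounded_compose_seq => i _; apply/semigroup_bounded/positive_part_ge0.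
Qed.

Lemma semigroup_seq_comm s g i t : 0 <= t ->
  semigroup_seq s g \o T i t = T i t \o semigroup_seq s g.
Proof.
by move=> t0; apply: compose_seq_comm => j _; apply: T_commute => //;
  exact: positive_part_ge0.
Qed.

Lemma semigroup_seq_update s g i t : uniq s -> i \in s -> g i <= 0 ->
  semigroup_seq s (update g i t) = T i (Num.max t 0) \o semigroup_seq s g.
Proof.
move=> us is_ gi0; rewrite /semigroup_seq (compose_seq_update (i := i)
  (F := fun i => T i (positive_part g i)))//.
- by rewrite /positive_part /update eqxx.
- by rewrite /positive_part max_r// semigroup0.
- by move=> j js ji; rewrite /positive_part /update (negPf ji).
- by move=> j js; apply: T_commute; exact: positive_part_ge0.
Qed.

Lemma semigroup_seq_indep (s s' : seq I) (h : I -> R) : uniq s -> uniq s' ->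
  (forall i, h i != 0 -> i \in s) -> (forall i, h i != 0 -> i \in s') ->
  semigroup_seq s h = semigroup_seq s' h.
Proof.
move=> us us' hs hs'; have T0 i : h i = 0 -> T i (positive_part h i) = idfun.
  by move=> hi; rewrite /positive_part hi maxxx semigroup0.
apply: compose_seq_indep => //.
- by move=> j k; apply: T_commute; exact: positive_part_ge0.
- by move=> i _ is'; apply: T0; apply/eqP; apply: contraNT is' => /hs'.
- by move=> i _ is_; apply: T0; apply/eqP; apply: contraNT is_ => /hs.
Qed.

End semigroup_seq.

Section prod_op_semigroup.
Context {R : realType} {H : hilbertType R} {I : choiceType}.
Context (T : I -> R -> H -> H) (T_semigroup : forall i, C0_semigroup (T i)).
Context (K : {fset I}) (f : I -> R) (t : K -> R).
Hypothesis ft : forall i : K, f (val i) = t i.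

Lemma prod_op_positive_part :
  prod_op (fun i : K => 0 < t i) (fun i : K => T (val i) (t i)) =
  semigroup_seq T [seq val i | i <- index_enum K] f.
Proof.
rewrite prod_op_compose_seq /semigroup_seq compose_seq_map.
apply: eq_compose_seq => i _ /=; rewrite /positive_part ft.
by case: ltP => // _; rewrite (semigroup0 T_semigroup).
Qed.

End prod_op_semigroup.

Lemma prod_op_negative_part (R : realType) (H : hilbertType R) (I : choiceType)
    (T : I -> R -> H -> H) (K : {fset I}) (f : I -> R) (t : K -> R) :
  (forall i, C0_semigroup (T i)) -> (forall i : K, f (val i) = t i) ->
  prod_op (fun i : K => t i < 0) (fun i : K => T (val i) (- t i)) =
  semigroup_seq T [seq val i | i <- index_enum K] (fun i => - f i).
Proof.
move=> T_semigroup ft.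
rewrite -(prod_op_positive_part T_semigroup (t := fun i => - t i)); last first.
  by move=> i; rewrite ft.
rewrite !prod_op_compose_seq; apply: eq_compose_seq => i _.
by rewrite oppr_gt0.
Qed.

Section dilation_brehmer.
Context {R : realType} {H H' : hilbertType R} {I : choiceType}.
Context (T : I -> R -> H -> H) (U : I -> R -> H' -> H') (r : H -> H').
Hypothesis T_semigroup : forall i, C0_semigroup (T i).
Hypothesis T_commute : commuting T.
Hypothesis U_semigroup : forall i, C0_semigroup (U i).
Hypothesis U_unitary : forall i t, 0 <= t -> unitary (U i t).
Hypothesis U_commute : commuting U.
Hypothesis r_bounded : bounded_op r.
Hypothesis r_dilation : forall (K : {fset I}) (t : K -> R),
  adjoint (prod_op (fun i : K => t i < 0) (fun i : K => T (val i) (- t i)))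
    \o prod_op (fun i : K => 0 < t i) (fun i : K => T (val i) (t i))
  = adjoint r
    \o prod_op predT (fun i : K => extend_group (U (val i)) (t i))
    \o r.

Local Notation E i := (extend_group (U i)).
Local Notation UU s g := (compose_seq s (fun i => extend_group (U i) (g i))).

Lemma extend_group_ge0 i t : 0 <= t -> E i t = U i t.
Proof. by rewrite /extend_group => ->. Qed.

Lemma extend_groupN i t : 0 <= t -> E i (- t) = adjoint (U i t).
Proof.
rewrite le_eqVlt => /orP[/eqP <-|t0]; last first.
  by rewrite /extend_group oppr_ge0 leNgt t0 opprK.
rewrite oppr0 extend_group_ge0//; have [_ U0 _ _] := U_semigroup i.
by rewrite U0; apply/funext => x; apply/esym/adjoint_eq => z.
Qed.

Lemma extend_group_commute i j a b : E i a \o E j b = E j b \o E i a.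
Proof.
have UE k c d l : 0 <= d -> U l d \o E k c = E k c \o U l d.
  move=> d0; have [c0|/ltW c0] := leP 0 c.
    by rewrite extend_group_ge0//; exact: U_commute.
  have e0 : 0 <= - c by rewrite oppr_ge0.
  rewrite -[c]opprK extend_groupN//; have [_ U1 U2] := U_unitary k e0.
  by apply/esym/(inverse_commute U1 U2); apply: U_commute.
have [a0|/ltW a0] := leP 0 a; first by rewrite (extend_group_ge0 i a0) UE.
have e0 : 0 <= - a by rewrite oppr_ge0.
rewrite -[a]opprK extend_groupN//; have [_ U1 U2] := U_unitary i e0.
by apply: inverse_commute U1 U2 _; apply: UE.
Qed.

Lemma extend_groupB i a x y : E i a (x - y) = E i a x - E i a y.
Proof.
have [a0|/ltW a0] := leP 0 a.
  rewrite extend_group_ge0//; case: (U_unitary i a0) => Ub _ _.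
  exact: bounded_opB.
have e0 : 0 <= - a by rewrite oppr_ge0.
rewrite -[a]opprK extend_groupN//; have [Ub _ _] := U_unitary i e0.
exact: adjointB.
Qed.

Lemma dotp_extend_groupN i t x y : 0 <= t ->
  dotp x (E i (- t) y) = dotp (E i t x) y.
Proof.
move=> t0; rewrite extend_groupN// extend_group_ge0//.
by have [Ub _ _] := U_unitary i t0; rewrite adjointP.
Qed.

Lemma extend_groupNK i t x : 0 <= t -> E i t (E i (- t) x) = x.
Proof.
move=> t0; rewrite extend_groupN// extend_group_ge0//.
by have [_ _ U2] := U_unitary i t0;
  rewrite -[LHS]/((U i t \o adjoint (U i t)) x) U2.
Qed.

(** This weak form of the dilation property does not involve adjoints, and the
    list s replaces the enumeration of the finite set of its entries. *)
Lemma dilation_seq (s : seq I) (g : I -> R) x y : uniq s ->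
  dotp (UU s g (r x)) (r y) =
  dotp (semigroup_seq T s g x) (semigroup_seq T s (fun i => - g i) y).
Proof.
move=> us; pose K := [fset i in s]%fset.
pose s' := [seq val i | i <- index_enum K].
have us' : uniq s' by exact: uniq_val_index_enum.
have s's i : (i \in s') = (i \in s) by rewrite mem_val_index_enum inE.
have enumK (Z : Type) (F : I -> Z -> Z) :
    (forall j k, F j \o F k = F k \o F j) -> compose_seq s' F = compose_seq s F.
  by move=> Fc; apply: compose_seq_indep => // i; rewrite s's => ->.
have := congr1 (fun f => dotp (f x) y) (@r_dilation K (fun i => g (val i))).
rewrite /= (adjointPl r_bounded) (prod_op_positive_part T_semigroup (f := g))//.
rewrite (prod_op_negative_part (f := g) T_semigroup)// adjointPl; last first.
  exact: semigroup_seq_bounded.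
rewrite prod_op_compose_seq -(compose_seq_map val (fun i => E i (g i))).
rewrite -/s' enumK; last by move=> j k; exact: extend_group_commute.
have semigroupE h : semigroup_seq T s' h = semigroup_seq T s h.
  by apply: enumK => j k; apply: T_commute; exact: positive_part_ge0.
by rewrite !semigroupE => ->.
Qed.

(** Expanded, this is the alternating sum, over the sublists C of s, of the
    vectors U_C(t_C)^-1 r (T_C(t_C) x). *)
Fixpoint brehmer_vector (s : seq I) (t : I -> R) (x : H) : H' :=
  if s is i :: s' then
    brehmer_vector s' t x - E i (- t i) (brehmer_vector s' t (T i (t i) x))
  else r x.

(** The identity is needed for g = 0 only, but the induction moves the unitaries
    U_i(t_i) and their inverses from the vectors to the times g, whose component
    at i was 0. Of the four inner products that arise for i :: s, the three that
    involve T_i(t_i) reduce to the same value, with signs -, - and +, whence the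
    decrease along T_i(t_i). *)
Lemma dotp_brehmer_vector (S s : seq I) (g t : I -> R) x y :
  uniq S -> uniq s -> {subset s <= S} -> (forall i, 0 <= t i) ->
  {in s, forall i, g i = 0} ->
  dotp (UU S g (brehmer_vector s t x)) (brehmer_vector s t y) =
  compose_seq s (fun i => decrease (T i (t i))) dotp
    (semigroup_seq T S g x) (semigroup_seq T S (fun i => - g i) y).
Proof.
move=> uS us sS t0; elim: s us sS g x y => [|i s IH] /=.
  by move=> _ _ g x y _; exact: dilation_seq.
move=> /andP[is_ us] sS g x y g0.
have iS : i \in S by apply: sS; rewrite mem_head.
have {}IH h u v : {in s, forall i, h i = 0} ->
  dotp (UU S h (brehmer_vector s t u)) (brehmer_vector s t v) =
  compose_seq s (fun i => decrease (T i (t i))) dotp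
    (semigroup_seq T S h u) (semigroup_seq T S (fun i => - h i) v).
  by apply: IH => // j js; apply: sS; rewrite inE js orbT.
have gi : g i = 0 by rewrite g0 ?mem_head.
have gs : {in s, forall i, g i = 0} by move=> j js; rewrite g0// inE js orbT.
have us0 a : {in s, forall j, update g i a j = 0}.
  move=> j js; rewrite /update gs//; case: eqVneq => // ji.
  by rewrite -ji js in is_.
have updN a : (fun j => - update g i a j) = update (fun j => - g j) i (- a).
  by apply/funext => j; rewrite /update; case: eqP.
have UU_update a : UU S (update g i a) = E i a \o UU S g.
  rewrite (compose_seq_update (i := i) (F := fun i => E i (g i)))//.
  - by rewrite /update eqxx.
  - by rewrite gi extend_group_ge0// (semigroup0 U_semigroup).
  - by move=> j js ji; rewrite /update (negPf ji).
  - by move=> j js; exact: extend_group_commute.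
have UU_E a : UU S g \o E i a = E i a \o UU S g.
  by apply: compose_seq_comm => j _; exact: extend_group_commute.
have TT h z : T i (t i) (semigroup_seq T S h z) =
  semigroup_seq T S h (T i (t i) z).
  by have := congr1 (fun f => f z) (semigroup_seq_comm T_commute S h i (t0 i)).
have TP h z : h i = 0 ->
    semigroup_seq T S (update h i (t i)) z = semigroup_seq T S h (T i (t i) z).
  by move=> hi; rewrite semigroup_seq_update// ?hi// max_l//= TT.
have TN h z : h i = 0 ->
    semigroup_seq T S (update h i (- t i)) z = semigroup_seq T S h z.
  move=> hi; rewrite semigroup_seq_update// ?hi// max_r ?oppr_le0//=.
  by rewrite (semigroup0 T_semigroup).
have Ngi : - g i = 0 by rewrite gi oppr0.
rewrite compose_seqB; last by move=> j u v; exact: extend_groupB.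
have UUE z : UU S g (E i (- t i) z) = UU S (update g i (- t i)) z.
  by rewrite UU_update -UU_E.
rewrite dotpBl !dotpBr !dotp_extend_groupN// UUE.
have UUP z : E i (t i) (UU S g z) =
  UU S (update g i (t i)) z by rewrite UU_update.
have UUK z : E i (t i) (UU S (update g i (- t i)) z) = UU S g z.
  by rewrite UU_update /= extend_groupNK.
rewrite UUK UUP.
rewrite !IH// !updN opprK !TP// !TN// /decrease !TT.
by ring.
Qed.

(** The iterated decrease of the inner product is the squared norm of the
    Brehmer vector. *)
Lemma dilation_brehmer (s : seq I) (t : I -> R) : uniq s ->
  (forall i, 0 <= t i) ->
  positive_form (compose_seq s (fun i => decrease (T i (t i))) dotp).
Proof.
move=> us t0 x.
have S0 (a : R) : a = 0 -> semigroup_seq T s (fun=> a) = idfun.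
  move=> a0; apply: compose_seq_id => i _.
  by rewrite /positive_part a0 maxxx (semigroup0 T_semigroup).
have U0 : UU s (fun=> 0) = idfun.
  apply: compose_seq_id => i _.
  by rewrite extend_group_ge0// (semigroup0 U_semigroup).
have := @dotp_brehmer_vector s s (fun=> 0) t x x us us (fun i is_ => is_) t0.
rewrite U0 !S0 ?oppr0//= => /(_ (fun _ _ => erefl)) <-; exact: dotp_ge0.
Qed.

End dilation_brehmer.

Section decrease_dissipation.
Context {R : realType} {H : hilbertType R} {I : eqType}.
Context (T : I -> R -> H -> H) (A : I -> H -> H).
Hypothesis T_semigroup : forall i, C0_semigroup (T i).
Hypothesis A_generator : forall i, bounded_generator (T i) (A i).

(** The iterated dissipation of a form at (x, y) is a finite combination of its
    values, so that the pointwise limit of the quotients passes through it. *)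
Lemma dissipation_seq_quotient_cvg (s : seq I) i Q x y : bounded_form Q ->
  (h^-1)%:C * dissipation_seq A s (decrease (T i h) Q) x y
    @[h --> (0 : R)^'+] -->
  (dissipation_seq A s (dissipation (A i) Q) x y : R[i]^o).
Proof.
move=> Qb; elim: s x y => [|j s IH] x y /=; first exact: decrease_quotient_cvg.
rewrite /dissipation.
under eq_fun do rewrite mulrN mulrDr.
by apply: cvg_oppD; exact: IH.
Qed.

(** The times tend to 0 one after the other: dividing by t_i and letting t_i
    decrease to 0 turns the decrease along T_i(t_i) into the dissipation along
    A i, and positivity survives. *)
Lemma dissipation_seq_cat_ge0 (s s' : seq I) : uniq s' ->
  (forall t : I -> R, (forall i, 0 <= t i) ->
    positive_form (dissipation_seq A s
      (compose_seq s' (fun i => decrease (T i (t i))) dotp))) ->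
  positive_form (dissipation_seq A (s ++ s') dotp).
Proof.
elim: s' s => [|i s' IH] s /=.
  by rewrite cats0 => _ /(_ (fun=> 0)); exact.
move=> /andP[is' us'] pos; rewrite -cat_rcons; apply: IH => // t t0 x.
have -> : dissipation_seq A (rcons s i)
      (compose_seq s' (fun j => decrease (T j (t j))) dotp) =
    dissipation_seq A s (dissipation (A i)
      (compose_seq s' (fun j => decrease (T j (t j))) dotp)).
  by rewrite /dissipation_seq /compose_seq foldr_rcons;
    elim: s {pos} => //= j s ->.
pose Q := compose_seq s' (fun j => decrease (T j (t j))) dotp; rewrite -/Q.
have Qb : bounded_form Q.
  rewrite {}/Q; elim: s' {is' us' pos} => [|j s' IH] /=.
    exact: bounded_form_dotp.
  apply: bounded_form_decrease => //; exact: (semigroup_bounded T_semigroup).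
have := @dissipation_seq_quotient_cvg s i Q x x Qb.
move=> /cvg_ge0; apply; near=> h.
have h0 : 0 < h by near: h; exact: nbhs_right_gt.
apply: mulr_ge0; first by rewrite ler0c invr_ge0 ltW.
have t'0 j : 0 <= update t i h j.
  by rewrite /update; case: eqP => // _; exact: ltW.
have := pos (update t i h) t'0 x; rewrite /update eqxx.
have -> : compose_seq s' (fun j => decrease (T j (if j == i then h else t j)))
  dotp = Q.
  rewrite /Q (eq_compose_seq (F' := fun j => decrease (T j (t j))))// => j js'.
  by case: eqVneq => // ji; rewrite -ji js' in is'.
by [].
Unshelve. all: by end_near. Qed.

End decrease_dissipation.

(** * Positivity of the regular kernel *)

Section kernel_positivity.
Context {R : realType} {H : hilbertType R} {I : eqType}.
Context (T : I -> R -> H -> H) (A : I -> H -> H).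
Hypothesis T_semigroup : forall i, C0_semigroup (T i).
Hypothesis T_commute : commuting T.
Hypothesis A_generator : forall i, bounded_generator (T i) (A i).
Implicit Types (s : seq I) (Q : H -> H -> R[i]).

(** For the inner product Q this is <T(t_-)^* T(t_+) x, y>, where t_+ and t_-
    are the positive and the negative part of t = g - g'. A general form Q is
    needed because the proof of positivity removes the indices of s one by one
    and thereby changes the form. *)
Definition regular_kernel s Q (g : I -> R) (x : H) (g' : I -> R) (y : H) :=
  Q (semigroup_seq T s (fun i => g i - g' i) x)
    (semigroup_seq T s (fun i => g' i - g i) y).

Lemma sesq_sum Q (l : seq nat) (x y : nat -> H) : bounded_form Q ->
  Q (\sum_(j <- l) x j) (\sum_(k <- l) y k) =
  \sum_(j <- l) \sum_(k <- l) Q (x j) (y k).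
Proof.
move=> Qb; have Qr u m : Q u (\sum_(k <- m) y k) = \sum_(k <- m) Q u (y k).
  elim: m => [|k m IH]; first by rewrite !big_nil (sesq0r Qb).
  by rewrite !big_cons (sesqDr Qb) IH.
have : forall m, Q (\sum_(j <- m) x j) (\sum_(k <- l) y k) =
  \sum_(j <- m) \sum_(k <- l) Q (x j) (y k).
  elim=> [|j m IH]; first by rewrite !big_nil (sesq0l Qb).
  by rewrite !big_cons (sesqDl Qb) IH Qr.
exact.
Qed.

Lemma double_sum_cons (f : nat -> nat -> R[i]) p l :
  \sum_(j <- p :: l) \sum_(k <- p :: l) f j k =
  f p p + \sum_(k <- l) f p k + \sum_(j <- l) f j p +
  \sum_(j <- l) \sum_(k <- l) f j k.
Proof.
rewrite big_cons big_cons -!addrA; congr (_ + (_ + _)).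
by rewrite -big_split/=; apply: eq_bigr => j _; rewrite big_cons.
Qed.

Lemma generator_semigroup_commute i j t : 0 <= t ->
  A i \o T j t = T j t \o A i.
Proof.
move=> t0; apply: (generator_commute (A_generator i)).
  exact: (semigroup_bounded T_semigroup).
by move=> h h0; exact: T_commute.
Qed.

Lemma generators_commute i j : A i \o A j = A j \o A i.
Proof.
apply: (generator_commute (A_generator i)).
  by case: (A_generator j).
by move=> h h0; rewrite generator_semigroup_commute.
Qed.

(** The generators commute with the semigroups. *)
Lemma dissipation_seq_decrease s i t Q : 0 <= t ->
  dissipation_seq A s (decrease (T i t) Q) =
    decrease (T i t) (dissipation_seq A s Q).
Proof.
move=> t0; elim: s => //= j s ->; apply/funext => x; apply/funext => y.
have AT z : A j (T i t z) = T i t (A j z).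
  by rewrite -[LHS]/((A j \o T i t) z) generator_semigroup_commute.
by rewrite /= /decrease /dissipation !AT; ring.
Qed.

(** Induction on s. Consider the i-th time g j i of a pair (g j, x j) as its
    position on a line, sort the pairs by position, and replace all pairs by
    their images under T_i at a position t below all of them, that is, x j by
    T_i(g j i - t) (x j). The double sum K of the kernel for i :: s is at least
    the double sum B t of the kernel for s with the images at t, which is
    nonnegative by induction. Indeed the double sums coincide in all terms that
    involve the first pair p if t is its position, and induction on the list of
    pairs applies to the remaining terms. Lowering t to a does not increase the
    sum B t, because the difference is the double sum of the kernel for s and
    the form decrease (T i (t - a)) Q, to which the induction hypothesis on s
    applies: the dissipations of that form are the decreases of the dissipations
    of Q. *)
Lemma regular_kernel_psd s Q : bounded_form Q ->
  (forall J, subseq J s -> positive_form (dissipation_seq A J Q)) ->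
  forall (l : seq nat) (g : nat -> I -> R) (x : nat -> H),
  0 <= \sum_(j <- l) \sum_(k <- l) regular_kernel s Q (g j) (x j) (g k) (x k).
Proof.
elim: s Q => [|i s IH] Q Qb Qpos l g x.
  by rewrite -sesq_sum//; exact: (Qpos [::]).
have TP t z h : 0 <= t -> semigroup_seq T s h (T i t z) =
  T i t (semigroup_seq T s h z).
  by move=> t0; have := congr1 (fun f => f z)
    (semigroup_seq_comm T_commute s h i t0).
have TD a b z : 0 <= a -> 0 <= b -> T i a (T i b z) = T i (a + b) z.
  by move=> a0 b0; have [_ _ -> //] := T_semigroup i.
have subs J : subseq J s -> subseq J (i :: s).
  by move=> Js; exact: subseq_trans Js (subseq_cons s i).
have IHQ := IH Q Qb (fun J Js => Qpos J (subs J Js)).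
have IHQ' t : 0 <= t -> forall (l : seq nat) g x, 0 <=
  \sum_(j <- l) \sum_(k <- l)
    regular_kernel s (decrease (T i t) Q) (g j) (x j) (g k) (x k).
  move=> t0; apply: IH => [|J Js].
    apply: bounded_form_decrease => //; exact: (semigroup_bounded T_semigroup).
  rewrite dissipation_seq_decrease//.
  apply: (decrease_ge0 (T_semigroup i) (A_generator i)) => //.
  - apply: bounded_dissipation_seq => // j; by case: (A_generator j).
  - exact/Qpos/subs.
  - by apply: (Qpos (i :: J)); rewrite /= eqxx.
pose K l := \sum_(j <- l) \sum_(k <- l)
  regular_kernel (i :: s) Q (g j) (x j) (g k) (x k).
pose y t j := T i (g j i - t) (x j).
pose B t j k := regular_kernel s Q (g j) (y t j) (g k) (y t k).
have KE j k : regular_kernel (i :: s) Q (g j) (x j) (g k) (x k) =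
    regular_kernel s Q (g j) (T i (Num.max (g j i - g k i) 0) (x j))
      (g k) (T i (Num.max (g k i - g j i) 0) (x k)).
  by rewrite /regular_kernel /= !TP// le_max lexx orbT.
(* Moving the images down from t to a. *)
have B_decr a t l' : a <= t -> {in l', forall j, t <= g j i} ->
    \sum_(j <- l') \sum_(k <- l') B a j k <=
      \sum_(j <- l') \sum_(k <- l') B t j k.
  move=> at_ tl; rewrite -subr_ge0 -sumrB.
  have ta0 : 0 <= t - a by rewrite subr_ge0.
  rewrite (le_trans (IHQ' _ ta0 l' g (y t)))// le_eqVlt;
    apply/orP/or_introl/eqP.
  rewrite big_seq [RHS]big_seq; apply: eq_bigr => j jl.
  rewrite -sumrB big_seq [RHS]big_seq; apply: eq_bigr => k kl.
  rewrite /B /regular_kernel /decrease /y -!TP// !TD ?subr_ge0 ?tl//.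
  by congr (_ - Q (_ (T i _ _)) (_ (T i _ _))); ring.
have KB t l' : sorted (fun j k => g j i <= g k i) l' ->
    {in l', forall j, t <= g j i} -> \sum_(j <- l') \sum_(k <- l') B t j k <=
      K l'.
  elim: l' t => [|p l' IHl] t; first by rewrite /K !big_nil.
  move=> /= pl tl; have tp : t <= g p i by apply: tl; rewrite mem_head.
  have pl' : {in l', forall j, g p i <= g j i}.
    by apply/allP; apply: order_path_min pl => a b c; exact: le_trans.
  (* First compare with the images at the position of the first pair. *)
  apply: le_trans (B_decr t (g p i) (p :: l') tp _) _.
    by move=> j; rewrite inE => /orP[/eqP ->//|/pl'].
  rewrite double_sum_cons [K (p :: l')]double_sum_cons.
  have Tmax0 (a b : R) : a <= b -> Num.max (a - b) 0 = 0.
    by move=> ab; rewrite max_r// subr_le0.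
  have Tmax1 (a b : R) : a <= b -> Num.max (b - a) 0 = b - a.
    by move=> ab; rewrite max_l// subr_ge0.
  apply: lerD; last exact: IHl (path_sorted pl) pl'.
  rewrite le_eqVlt; apply/orP/or_introl/eqP; congr (_ + _ + _).
  - by rewrite KE Tmax0// /B /y subrr.
  - rewrite big_seq [RHS]big_seq; apply: eq_bigr => j jl.
    by rewrite KE Tmax0 ?pl'// Tmax1 ?pl'// /B /y subrr.
  - rewrite big_seq [RHS]big_seq; apply: eq_bigr => j jl.
    by rewrite KE Tmax1 ?pl'// Tmax0 ?pl'// /B /y subrr.
pose r j k := g j i <= g k i.
have r_total : total r by move=> j k; exact: le_total.
have -> : \sum_(j <- l) \sum_(k <- l) regular_kernel (i :: s) Q (g j) (x j)
  (g k) (x k)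
    = K (sort r l).
  rewrite /K; have ls := perm_sym l (sort r l);
    rewrite perm_sort perm_refl in ls.
  rewrite [LHS](perm_big (sort r l)) ?ls//; apply: eq_bigr => j _.
  by rewrite (perm_big (sort r l)) ?ls.
have := sort_sorted r_total l; case: (sort r l) => [|p l' pl].
  by rewrite /K big_nil.
apply: le_trans (KB (g p i) _ pl _); first exact: IHQ.
move=> j; rewrite inE => /orP[/eqP ->//|]; move: j; apply/allP.
by apply: order_path_min pl => a b c; exact: le_trans.
Qed.

End kernel_positivity.

(** * The Hilbert space of a positive kernel *)

Section modulus.
Context {R : realType}.
Implicit Types z w : R[i].

Definition modulus z : R := Re `|z|.

Lemma modulusE z : `|z| = (modulus z)%:C.
Proof. by rewrite /modulus; case: (ge0_complex (normr_ge0 z)) => e _ ->. Qed.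

Lemma modulus_ge0 z : 0 <= modulus z.
Proof. by rewrite -ler0c -modulusE. Qed.

Lemma modulusD z w : modulus (z + w) <= modulus z + modulus w.
Proof. by rewrite -lecR rmorphD/= -!modulusE ler_normD. Qed.

Lemma modulusM z w : modulus (z * w) = modulus z * modulus w.
Proof. by apply: complexI; rewrite rmorphM/= -!modulusE normrM. Qed.

Lemma modulusN z : modulus (- z) = modulus z.
Proof. by rewrite /modulus normrN. Qed.

Lemma modulus0 : modulus 0 = 0.
Proof. by rewrite /modulus normr0. Qed.

Lemma modulus0_eq0 z : modulus z = 0 -> z = 0.
Proof. by move=> z0; apply/eqP; rewrite -normr_eq0 modulusE z0. Qed.

Lemma modulus_real (e : R) : 0 <= e -> modulus e%:C = e.
Proof. by move=> e0; rewrite /modulus ger0_norm ?ler0c. Qed.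

End modulus.

Record psd_kernel (R : realType) (X : Type) := PsdKernel {
  kernel_fun :> X -> X -> R[i] ;
  kernelJ : forall x y, kernel_fun x y = (kernel_fun y x)^* ;
  kernel_psd : forall l : seq (R[i] * X),
    0 <= \sum_(p <- l) \sum_(q <- l) p.1 * q.1^* * kernel_fun p.2 q.2 }.

Section rkhs.
Context {R : realType} {X : Type} (K : psd_kernel R X).
Implicit Types (l m : seq (R[i] * X)) (f g : X -> R[i]) (a : R[i]).

Definition comb_scale a l := [seq (a * p.1, p.2) | p <- l].

Definition comb_dot l m : R[i] :=
  \sum_(p <- l) \sum_(q <- m) p.1 * q.1^* * K p.2 q.2.

Definition comb_norm l : R := Num.sqrt (Re (comb_dot l l)).

(** This is the inner product of the function f and the combination of kernel
    functions with the coefficients and points in m. *)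
Definition pairing f m : R[i] := \sum_(q <- m) q.1^* * f q.2.

Definition comb_fun l : X -> R[i] := fun y => \sum_(p <- l) p.1 * K p.2 y.

Lemma pairing_comb_fun l m : pairing (comb_fun l) m = comb_dot l m.
Proof.
rewrite /comb_dot exchange_big; apply: eq_bigr => q _.
by rewrite mulr_sumr; apply: eq_bigr => p _; ring.
Qed.

Lemma comb_dotJ l m : comb_dot l m = (comb_dot m l)^*.
Proof.
rewrite /comb_dot exchange_big [RHS]rmorph_sum; apply: eq_bigr => q _.
rewrite [RHS]rmorph_sum; apply: eq_bigr => p _.
by rewrite kernelJ -[RHS]/((q.1 * p.1^* * K q.2 p.2)^*) !conjcM conjcK; ring.
Qed.

Lemma comb_dot_catl l l' m : comb_dot (l ++ l') m =
  comb_dot l m + comb_dot l' m.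
Proof. by rewrite /comb_dot big_cat. Qed.

Lemma comb_dot_catr l m m' : comb_dot l (m ++ m') =
  comb_dot l m + comb_dot l m'.
Proof. by rewrite comb_dotJ comb_dot_catl conjcD -!comb_dotJ. Qed.

Lemma comb_dot_scalel a l m : comb_dot (comb_scale a l) m = a * comb_dot l m.
Proof.
rewrite /comb_dot big_map mulr_sumr; apply: eq_bigr => p _.
by rewrite mulr_sumr; apply: eq_bigr => q _; rewrite !mulrA.
Qed.

Lemma comb_dot_scaler a l m : comb_dot l (comb_scale a m) = a^* * comb_dot l m.
Proof. by rewrite comb_dotJ comb_dot_scalel conjcM -comb_dotJ. Qed.

Lemma comb_dot_ge0 l : 0 <= comb_dot l l.
Proof. exact: kernel_psd. Qed.

Lemma comb_norm_ge0 l : 0 <= comb_norm l.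
Proof. exact: sqrtr_ge0. Qed.

Lemma comb_normE l : comb_dot l l = (comb_norm l ^+ 2)%:C.
Proof.
have [e e0 E] := ge0_complex (comb_dot_ge0 l).
by rewrite /comb_norm E/= sqr_sqrtr.
Qed.

Lemma comb_cauchy_schwarz l m :
  modulus (comb_dot l m) <= comb_norm l * comb_norm m.
Proof.
rewrite -(@ler_pXn2r _ 2)// ?nnegrE ?mulr_ge0 ?modulus_ge0 ?comb_norm_ge0//.
rewrite -lecR.
have -> : ((comb_norm l * comb_norm m) ^+ 2)%:C = comb_dot l l * comb_dot m m.
  by rewrite !comb_normE -rmorphM -exprMn.
have -> : (modulus (comb_dot l m) ^+ 2)%:C = `|comb_dot l m| ^+ 2.
  by rewrite modulusE -rmorphXn.
suff /psd2_cauchy_schwarz[] : forall a b : R[i], 0 <= a * a^* * comb_dot l l +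
    a * b^* * comb_dot l m + b * a^* * (comb_dot l m)^* + b * b^* * comb_dot m m
      by [].
move=> a b; have := comb_dot_ge0 (comb_scale a l ++ comb_scale b m).
congr (_ <= _); rewrite comb_dot_catl !comb_dot_catr.
by rewrite !comb_dot_scalel !comb_dot_scaler -(comb_dotJ m l); ring.
Qed.

Lemma pairingD f g m : pairing (fun x => f x + g x) m =
  pairing f m + pairing g m.
Proof. by rewrite -big_split; apply: eq_bigr => q _; rewrite mulrDr. Qed.

Lemma pairingZ a f m : pairing (fun x => a * f x) m = a * pairing f m.
Proof. by rewrite mulr_sumr; apply: eq_bigr => q _; rewrite mulrCA. Qed.

Lemma pairingN f m : pairing (fun x => - f x) m = - pairing f m.
Proof. by rewrite -sumrN; apply: eq_bigr => q _; rewrite mulrN. Qed.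

Lemma pairing1 f x : pairing f [:: (1, x)] = f x.
Proof. by rewrite /pairing big_seq1 conjc1 mul1r. Qed.

Lemma comb_fun_cat l l' x : comb_fun (l ++ l') x = comb_fun l x + comb_fun l' x.
Proof. by rewrite /comb_fun big_cat. Qed.

Lemma comb_fun_scale a l x : comb_fun (comb_scale a l) x = a * comb_fun l x.
Proof.
by rewrite /comb_fun big_map mulr_sumr; apply: eq_bigr => p _; rewrite mulrA.
Qed.

Definition bounded_by f (c : R) := forall m, modulus (pairing f m) <=
  c * comb_norm m.

(** The functions f for which the functional pairing f is a limit of inner
    products with combinations, in the sense of bounds on functionals. This
    completes the space of combinations without a quotient, even if the kernel
    is degenerate: combinations at distance 0 are the same function. *)
Definition approximable f := forall e : R, 0 < e ->
  exists l, bounded_by (fun x => f x - comb_fun l x) e.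

Lemma bounded_byD f g c d : bounded_by f c -> bounded_by g d ->
  bounded_by (fun x => f x + g x) (c + d).
Proof.
move=> fc gd m; rewrite pairingD (le_trans (modulusD _ _))//.
by rewrite mulrDl lerD.
Qed.

Lemma bounded_byZ a f c : bounded_by f c ->
  bounded_by (fun x => a * f x) (modulus a * c).
Proof.
by move=> fc m; rewrite pairingZ modulusM -mulrA ler_wpM2l ?modulus_ge0.
Qed.

Lemma bounded_by_comb_fun l : bounded_by (comb_fun l) (comb_norm l).
Proof. by move=> m; rewrite pairing_comb_fun comb_cauchy_schwarz. Qed.

Lemma bounded_by_le f c d : c <= d -> bounded_by f c -> bounded_by f d.
Proof.
by move=> cd fc m; rewrite (le_trans (fc m))// ler_wpM2r// comb_norm_ge0.
Qed.

Lemma eq_bounded_by f g c : (forall x, f x = g x) -> bounded_by f c ->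
  bounded_by g c.
Proof. by move=> /funext ->. Qed.

Lemma approximable_comb_fun l : approximable (comb_fun l).
Proof.
move=> e e0; exists l => m; rewrite /pairing big1 ?modulus0; last first.
  by move=> q _; rewrite subrr mulr0.
by rewrite mulr_ge0 ?comb_norm_ge0// ltW.
Qed.

Lemma approximableD f g : approximable f -> approximable g ->
  approximable (fun x => f x + g x).
Proof.
move=> fa ga e e0; have e20 : 0 < e / 2 by rewrite divr_gt0.
have [l fl] := fa _ e20; have [l' gl'] := ga _ e20; exists (l ++ l').
rewrite [e]splitr; apply: eq_bounded_by (bounded_byD fl gl') => x.
by rewrite comb_fun_cat; ring.
Qed.

Lemma approximableZ a f : approximable f -> approximable (fun x => a * f x).
Proof.
move=> fa e e0; have a0 : 0 < modulus a + 1 by rewrite ltr_wpDl ?modulus_ge0.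
have [l fl] := fa _ (divr_gt0 e0 a0); exists (comb_scale a l).
have ae : modulus a * (e / (modulus a + 1)) <= e.
  rewrite mulrCA ger_pMr// ler_pdivrMr// mul1r lerDl ler01 //.
apply: eq_bounded_by (bounded_by_le ae (bounded_byZ a fl)) => x.
by rewrite comb_fun_scale mulrBr.
Qed.

Record rkhs := Rkhs { rkhs_fun :> X -> R[i]; rkhsP : approximable rkhs_fun }.

Implicit Types u v w : rkhs.

Lemma rkhs_eq u v : (forall x, u x = v x) -> u = v.
Proof.
case: u v => [f fa] [g ga] /= /funext fg; case: _ / fg ga => ga.
by congr Rkhs; exact: Prop_irrelevance.
Qed.

Lemma approximable0 : approximable (fun=> 0).
Proof.
move=> e e0; exists [::] => m; rewrite /pairing big1 ?modulus0; last first.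
  by move=> q _; rewrite /comb_fun big_nil subr0 mulr0.
by rewrite mulr_ge0 ?comb_norm_ge0// ltW.
Qed.

Lemma approximableN f : approximable f -> approximable (fun x => - f x).
Proof.
move=> /(approximableZ (-1)); congr approximable.
by apply/funext => x; rewrite mulN1r.
Qed.

Definition rkhs_zero := Rkhs approximable0.
Definition rkhs_add u v := Rkhs (approximableD (rkhsP u) (rkhsP v)).
Definition rkhs_opp u := Rkhs (approximableN (rkhsP u)).
Definition rkhs_scale a u := Rkhs (approximableZ a (rkhsP u)).

Lemma rkhs_addA : associative rkhs_add.
Proof. by move=> u v w; apply: rkhs_eq => x; exact: addrA. Qed.
Lemma rkhs_addC : commutative rkhs_add.
Proof. by move=> u v; apply: rkhs_eq => x; exact: addrC. Qed.
Lemma rkhs_add0 : left_id rkhs_zero rkhs_add.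
Proof. by move=> u; apply: rkhs_eq => x; exact: add0r. Qed.
Lemma rkhs_addN : left_inverse rkhs_zero rkhs_opp rkhs_add.
Proof. by move=> u; apply: rkhs_eq => x; exact: addNr. Qed.

HB.instance Definition _ := gen_eqMixin rkhs.
HB.instance Definition _ := gen_choiceMixin rkhs.
HB.instance Definition _ :=
  GRing.isZmodule.Build rkhs rkhs_addA rkhs_addC rkhs_add0 rkhs_addN.

Lemma rkhs_scaleA a b u : rkhs_scale a (rkhs_scale b u) = rkhs_scale (a * b) u.
Proof. by apply: rkhs_eq => x; exact: mulrA. Qed.
Lemma rkhs_scale1 : left_id 1 rkhs_scale.
Proof. by move=> u; apply: rkhs_eq => x; exact: mul1r. Qed.
Lemma rkhs_scaleDr : right_distributive rkhs_scale +%R.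
Proof. by move=> a u v; apply: rkhs_eq => x; exact: mulrDr. Qed.
Lemma rkhs_scaleDl u : {morph rkhs_scale^~ u : a b / a + b}.
Proof. by move=> a b; apply: rkhs_eq => x; exact: mulrDl. Qed.

HB.instance Definition _ := GRing.Zmodule_isLmodule.Build R[i] rkhs
  rkhs_scaleA rkhs_scale1 rkhs_scaleDr rkhs_scaleDl.

Definition rkhs_bounds u := [set c : R | 0 <= c /\ bounded_by u c].

(** This is the operator norm of the functional pairing u on the space of
    combinations with the seminorm comb_norm. *)
Definition rkhs_norm u : R := inf (rkhs_bounds u).

Lemma rkhs_has_inf u : has_inf (rkhs_bounds u).
Proof.
split; last by exists 0 => c [].
have [l ul] := rkhsP u ltr01; exists (1 + comb_norm l); split.
  by rewrite addr_ge0// comb_norm_ge0.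
apply: eq_bounded_by (bounded_byD ul (@bounded_by_comb_fun l)) => x.
by rewrite subrK.
Qed.

Lemma rkhs_norm_ge0 u : 0 <= rkhs_norm u.
Proof. by apply: lb_le_inf => [|c []//]; case: (rkhs_has_inf u). Qed.

Lemma rkhs_norm_le u c : 0 <= c -> bounded_by u c -> rkhs_norm u <= c.
Proof. by move=> c0 uc; apply: ge_inf; [case: (rkhs_has_inf u)|]. Qed.

Lemma rkhs_norm_bound u : bounded_by u (rkhs_norm u).
Proof.
move=> m; have [m0|m0] := eqVneq (comb_norm m) 0.
  by have [[c [_ uc]] _] := rkhs_has_inf u; have := uc m; rewrite m0 !mulr0.
have {}m0 : 0 < comb_norm m by rewrite lt_neqAle eq_sym m0 comb_norm_ge0.
rewrite -ler_pdivrMr//; apply: lb_le_inf; first by case: (rkhs_has_inf u).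
by move=> c [_ uc]; rewrite ler_pdivrMr.
Qed.

Lemma rkhs_normD u v : (rkhs_norm (u + v))%:C <=
  (rkhs_norm u)%:C + (rkhs_norm v)%:C.
Proof.
rewrite -rmorphD lecR; apply: rkhs_norm_le.
  by rewrite addr_ge0// rkhs_norm_ge0.
exact: bounded_byD (@rkhs_norm_bound u) (@rkhs_norm_bound v).
Qed.

Lemma rkhs_normZ a u : (rkhs_norm (a *: u))%:C = `|a| * (rkhs_norm u)%:C.
Proof.
have le b v : rkhs_norm (b *: v) <= modulus b * rkhs_norm v.
  apply: rkhs_norm_le; first by rewrite mulr_ge0 ?modulus_ge0 ?rkhs_norm_ge0.
  exact: bounded_byZ (@rkhs_norm_bound v).
rewrite modulusE -rmorphM; congr _%:C; apply/eqP; rewrite eq_le le/=.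
have [->|a0] := eqVneq a 0; first by rewrite modulus0 mul0r rkhs_norm_ge0.
have ma0 : 0 < modulus a.
  by rewrite lt_neqAle modulus_ge0 andbT eq_sym;
    apply: contra_neq a0 => /modulus0_eq0.
have := le a^-1 (a *: u); rewrite scalerA mulVf// scale1r.
rewrite -(ler_pM2l ma0) mulrA -modulusM divff// (_ : modulus 1 = 1) ?mul1r//.
by rewrite /modulus normr1.
Qed.

Lemma rkhs_norm_eq0 u : (rkhs_norm u)%:C = 0 -> u = 0.
Proof.
move=> /complexI u0; apply: rkhs_eq => x; apply: modulus0_eq0.
have := @rkhs_norm_bound u [:: (1, x)]; rewrite u0 mul0r pairing1 => ux.
by apply/eqP; rewrite eq_le ux modulus_ge0.
Qed.

HB.instance Definition _ := Lmodule_isNormed.Build R[i] rkhs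
  rkhs_normD rkhs_normZ rkhs_norm_eq0.

Lemma rkhs_normE u : `|u| = (rkhs_norm u)%:C.
Proof. by []. Qed.

Lemma rkhs_norm_lt u e : `|u| < e%:C -> bounded_by u e.
Proof.
rewrite rkhs_normE ltcR => /ltW ue.
exact: bounded_by_le ue (@rkhs_norm_bound u).
Qed.

Lemma rkhs_cauchy_ex (F : set_system rkhs) : ProperFilter F -> cauchy F ->
  forall e : R, 0 < e -> exists u : rkhs, \forall v \near F,
    bounded_by (fun x => u x - rkhs_fun v x) e.
Proof.
move=> FF /cauchyP Fc e e0; have [|u uF] := Fc e%:C; first by rewrite ltcR.
exists u; apply: filterS uF => v; rewrite -ball_normE /= => uv.
exact: (@rkhs_norm_lt (u - v)).
Qed.

(** Evaluation at a point is a bounded functional. *)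
Lemma rkhs_pointwise_cvg (F : set_system rkhs) : ProperFilter F -> cauchy F ->
  exists g : X -> R[i], forall x (e : R), 0 < e ->
    \forall v \near F, modulus (g x - rkhs_fun v x) < e.
Proof.
move=> FF Fc.
have part (P : R[i] -> R) : (forall z z' : R[i], P (z - z') = P z - P z') ->
    (forall z, `|P z| <= modulus z) -> forall x,
    cvg (P (rkhs_fun v x) @[v --> F]).
  move=> PB Ple x; apply: R_complete; apply/cauchyP => e e0.
  have s0 : 0 < comb_norm [:: (1, x)] + 1 by rewrite ltr_wpDl ?comb_norm_ge0.
  have [u uF] := rkhs_cauchy_ex FF Fc (divr_gt0 e0 s0).
  exists (P (u x)); apply: filterS uF => v /(_ [:: (1, x)]).
  rewrite pairing1 => uv; rewrite -ball_normE/= -PB (le_lt_trans (Ple _))//.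
  rewrite (le_lt_trans uv)// -mulrA gtr_pMr// mulrC ltr_pdivrMr// mul1r ltrDl//.
have RePx x : cvg (Re (rkhs_fun v x) @[v --> F]).
  apply: part => [z z'|z]; first exact: raddfB.
  by rewrite -lecR -modulusE norm_Re_le.
have ImPx x : cvg (Im (rkhs_fun v x) @[v --> F]).
  apply: part => [z z'|z]; first exact: raddfB.
  by rewrite -lecR -modulusE norm_Im_le.
exists (fun x => lim (Re (rkhs_fun v x) @[v --> F]) +i*
  lim (Im (rkhs_fun v x) @[v --> F])).
move=> x e e0; have e20 : 0 < e / 2 by rewrite divr_gt0.
have /cvgrPdist_lt /(_ _ e20) Re_lt := RePx x.
have /cvgrPdist_lt /(_ _ e20) Im_lt := ImPx x.
near=> v; rewrite [e]splitr -ltcR -modulusE (le_lt_trans (norm_le_ReIm _))//.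
rewrite -rmorphD ltcR /= !raddfB /=; apply: ltrD; [near: v; exact: Re_lt|].
by near: v; exact: Im_lt.
Unshelve. all: by end_near. Qed.

(** The bounds on the functionals persist in the pointwise limit, which
    therefore is approximable and the limit in norm. *)
Lemma rkhs_complete (F : set_system rkhs) : ProperFilter F -> cauchy F -> cvg F.
Proof.
move=> FF Fc; have [g gF] := rkhs_pointwise_cvg FF Fc.
have gm m (e : R) : 0 < e ->
    \forall v \near F, modulus (pairing (fun x => g x - rkhs_fun v x) m) < e.
  elim: m e => [|q m IH] e e0.
    by apply: nearW => v; rewrite /pairing big_nil modulus0.
  have e20 : 0 < e / 2 by rewrite divr_gt0.
  have q0 : 0 < modulus q.1^* + 1 by rewrite ltr_wpDl ?modulus_ge0.
  near=> v; rewrite /pairing big_cons (le_lt_trans (modulusD _ _))//.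
  rewrite [e]splitr; apply: ltrD; last by near: v; exact: IH.
  rewrite modulusM (@le_lt_trans _ _
    ((modulus q.1^* + 1) * modulus (g q.2 - v q.2)))//.
    by rewrite ler_wpM2r ?modulus_ge0// lerDl.
  by rewrite mulrC -ltr_pdivlMr//; near: v; apply: gF; rewrite divr_gt0.
have gu (e : R) : 0 < e -> exists u : rkhs, bounded_by (fun x => g x - u x) e /\
    (\forall v \near F, bounded_by (fun x => u x - rkhs_fun v x) e).
  move=> e0; have [u uF] := rkhs_cauchy_ex FF Fc e0; exists u; split=> // m.
  apply/ler_addgt0Pl => d d0.
  have [v []] := filter_ex (filterI uF (gm m d d0)) => uv gv.
  have -> : (fun x => g x - u x) = (fun x => (g x - v x) + - (u x - v x)).
    by apply/funext => x; rewrite opprB addrA subrK.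
  rewrite pairingD (le_trans (modulusD _ _))//; apply: lerD; first exact: ltW.
  by rewrite pairingN modulusN.
have ga : approximable g.
  move=> e e0; have e20 : 0 < e / 2 by rewrite divr_gt0.
  have [u [gu' _]] := gu _ e20; have [l ul] := rkhsP u e20; exists l.
  rewrite [e]splitr; apply: eq_bounded_by (bounded_byD gu' ul) => x.
  by rewrite addrA subrK.
apply/cvg_ex; exists (Rkhs ga); apply/cvgrPdist_lt => _ /gt0_complex [e e0 ->].
have e30 : 0 < e / 4 by rewrite divr_gt0.
have [u [gu' uF]] := gu _ e30; apply: filterS uF => v uv.
rewrite rkhs_normE ltcR (@le_lt_trans _ _ (e / 4 + e / 4))//; last by lra.
apply: rkhs_norm_le; first lra.
apply: eq_bounded_by (bounded_byD gu' uv) => x.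
by rewrite addrA subrK.
Unshelve. all: by end_near. Qed.

HB.instance Definition _ := Uniform_isComplete.Build rkhs rkhs_complete.

End rkhs.

(** * The inner product of the kernel space *)

Section rkhs_dot.
Context {R : realType} {X : Type} (K : psd_kernel R X).
Implicit Types (l m : seq (R[i] * X)) (u v w : rkhs K) (a : R[i]).

Definition rkhs_comb l : rkhs K := Rkhs (approximable_comb_fun K l).

Lemma rkhs_combD l m : rkhs_comb l + rkhs_comb m = rkhs_comb (l ++ m).
Proof. by apply: rkhs_eq => x; rewrite /= comb_fun_cat. Qed.

Lemma rkhs_combZ a l : a *: rkhs_comb l = rkhs_comb (comb_scale a l).
Proof. by apply: rkhs_eq => x; rewrite /= comb_fun_scale. Qed.

Lemma rkhs_norm_comb l : rkhs_norm (rkhs_comb l) = comb_norm K l.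
Proof.
apply/eqP; rewrite eq_le rkhs_norm_le ?comb_norm_ge0//=; last first.
  exact: bounded_by_comb_fun.
have := @rkhs_norm_bound _ _ K (rkhs_comb l) l.
rewrite /= pairing_comb_fun comb_normE modulus_real ?sqr_ge0//.
have [->|l0] := eqVneq (comb_norm K l) 0; first by rewrite rkhs_norm_ge0.
by rewrite expr2 ler_pM2r// lt_neqAle eq_sym l0 comb_norm_ge0.
Qed.

Lemma rkhs_comb_dense u : exists l : nat -> seq (R[i] * X),
  rkhs_comb (l n) @[n --> \oo] --> u.
Proof.
have /choice [l lP] : forall n : nat, exists l,
    bounded_by K (fun x => u x - comb_fun K l x) n.+1%:R^-1.
  by move=> n; apply: rkhsP; rewrite invr_gt0.
exists l; apply/cvgrPdist_lt => _ /gt0_complex [e e0 ->].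
have [N _ Ne] := cvgr_lt 0 (@cvg_harmonic R) _ e0.
exists N => // n /Ne ne; rewrite rkhs_normE ltcR (le_lt_trans _ ne)//.
by apply: rkhs_norm_le; [rewrite invr_ge0|exact: lP].
Qed.

(** The real part of the inner product, by polarization. Defined through the
    norm, it is continuous, and its algebraic properties that do not follow at
    once extend from the dense set of combinations. *)
Definition rkhs_rdot u v : R :=
  4^-1 * (rkhs_norm (u + v) ^+ 2 - rkhs_norm (u - v) ^+ 2).

Lemma rkhs_norm_cvg (u_ : nat -> rkhs K) u :
  u_ n @[n --> \oo] --> u -> rkhs_norm (u_ n) @[n --> \oo] --> rkhs_norm u.
Proof.
move=> uu; have : `|u_ n| @[n --> \oo] --> (`|u| : R[i]^o) by exact:
  (@cvg_norm _ (rkhs K)).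
exact: cvg_Re.
Qed.

Lemma rkhs_rdot_cvg (u_ v_ : nat -> rkhs K) u v :
  u_ n @[n --> \oo] --> u -> v_ n @[n --> \oo] --> v ->
  rkhs_rdot (u_ n) (v_ n) @[n --> \oo] --> rkhs_rdot u v.
Proof.
move=> uu vv; apply: cvgMr; apply: cvgB.
  by apply: (@cvgM R); apply: rkhs_norm_cvg; apply: (@cvgD _ (rkhs K)).
by apply: (@cvgM R); apply: rkhs_norm_cvg; apply: (@cvgB _ (rkhs K)).
Qed.

Lemma rkhs_rdot_comb l m :
  rkhs_rdot (rkhs_comb l) (rkhs_comb m) = Re (comb_dot K l m).
Proof.
rewrite /rkhs_rdot -[- rkhs_comb m]scaleN1r rkhs_combZ !rkhs_combD
  !rkhs_norm_comb.
have E k : comb_norm K k ^+ 2 = Re (comb_dot K k k) by rewrite comb_normE.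
rewrite !E !comb_dot_catl !comb_dot_catr !comb_dot_scalel !comb_dot_scaler.
rewrite (comb_dotJ K m l).
case: (comb_dot K l m) (comb_dot K l l) (comb_dot K m m) => a b [c d] [e f].
by simpc => /=; field.
Qed.

Lemma rkhs_rdotC u v : rkhs_rdot u v = rkhs_rdot v u.
Proof.
rewrite /rkhs_rdot [v + u]addrC -(opprB v u).
suff N w : rkhs_norm (- w) = rkhs_norm w by rewrite N.
by apply: complexI; rewrite -!rkhs_normE normrN.
Qed.

Lemma rkhs_rdot_i u v : rkhs_rdot ('i *: u) ('i *: v) = rkhs_rdot u v.
Proof.
have N w : rkhs_norm ('i *: w) = rkhs_norm w.
  apply: complexI; rewrite -!rkhs_normE normrZ normc_def /= expr0n expr1n add0r.
  by rewrite sqrtr1 mul1r.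
by rewrite /rkhs_rdot -scalerDr -scalerBr !N.
Qed.

(** Both sides are continuous and agree for combinations. *)
Lemma rkhs_rdotPl (a : R) u v w :
  rkhs_rdot (a%:C *: u + v) w = a * rkhs_rdot u w + rkhs_rdot v w.
Proof.
have [l lu] := rkhs_comb_dense u; have [m mv] := rkhs_comb_dense v.
have [k kw] := rkhs_comb_dense w.
have L : rkhs_rdot (a%:C *: rkhs_comb (l n) + rkhs_comb (m n)) (rkhs_comb (k n))
    @[n --> \oo] --> rkhs_rdot (a%:C *: u + v) w.
  apply: rkhs_rdot_cvg => //; apply: (@cvgD _ (rkhs K)) => //.
  exact: (@cvgZl_tmp _ (rkhs K)).
have L' : a * rkhs_rdot (rkhs_comb (l n)) (rkhs_comb (k n)) +
    rkhs_rdot (rkhs_comb (m n)) (rkhs_comb (k n))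
    @[n --> \oo] --> a * rkhs_rdot u w + rkhs_rdot v w.
  by apply: (@cvgD R R); [apply: cvgMr|]; exact: rkhs_rdot_cvg.
apply: (cvg_unique (@norm_hausdorff _ R) L).
apply: cvg_trans L'; apply: near_eq_cvg; apply: nearW => n.
rewrite rkhs_combZ rkhs_combD !rkhs_rdot_comb comb_dot_catl comb_dot_scalel.
by rewrite ReD ReZ.
Qed.

Lemma rkhs_rdotDl u v w : rkhs_rdot (u + v) w = rkhs_rdot u w + rkhs_rdot v w.
Proof. by rewrite -[u]scale1r rkhs_rdotPl mul1r scale1r. Qed.

Lemma rkhs_rdot0l w : rkhs_rdot 0 w = 0.
Proof. by apply: (addrI (rkhs_rdot 0 w)); rewrite -rkhs_rdotDl !addr0. Qed.

Lemma rkhs_rdotZl (a : R) u w : rkhs_rdot (a%:C *: u) w = a * rkhs_rdot u w.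
Proof. by rewrite -[_ *: u]addr0 rkhs_rdotPl rkhs_rdot0l addr0. Qed.

(** Multiplication of both arguments by i is harmless, and i ^ 2 = - 1. *)
Lemma rkhs_rdot_il u v : rkhs_rdot ('i *: u) v = - rkhs_rdot u ('i *: v).
Proof.
rewrite -[LHS]rkhs_rdot_i scalerA -expr2 sqr_i.
by rewrite (_ : -1 = (-1)%:C) ?rkhs_rdotZl ?mulN1r// rmorphN.
Qed.

Definition rkhs_dot u v : R[i] := rkhs_rdot u v +i* rkhs_rdot u ('i *: v).

Lemma rkhs_dotPl a u v w : rkhs_dot (a *: u + v) w =
  a * rkhs_dot u w + rkhs_dot v w.
Proof.
case: a => p q; have -> : (p +i* q) *: u = p%:C *: u + q%:C *: ('i *: u).
  by rewrite scalerA -scalerDl; congr (_ *: u); simpc.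
rewrite /rkhs_dot !rkhs_rdotDl !rkhs_rdotZl !rkhs_rdot_i !rkhs_rdot_il.
by simpc; congr (_ +i* _); ring.
Qed.

Lemma rkhs_dotJ u v : rkhs_dot u v = (rkhs_dot v u)^*.
Proof.
by rewrite /rkhs_dot/= [rkhs_rdot u ('i *: v)]rkhs_rdotC rkhs_rdot_il
  rkhs_rdotC.
Qed.

Lemma rkhs_dotE u : rkhs_dot u u = `|u| ^+ 2.
Proof.
have u0 : rkhs_rdot u ('i *: u) = 0.
  by have := rkhs_rdot_il u u; rewrite rkhs_rdotC; lra.
rewrite /rkhs_dot u0 rkhs_normE -rmorphXn; congr (_ +i* _).
rewrite /rkhs_rdot subrr -mulr2n -[u *+ 2](@scaler_nat R[i]).
have -> : rkhs_norm (2%:R *: u) = 2 * rkhs_norm u.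
  by apply: complexI; rewrite -rkhs_normE normrZ normr_nat rmorphM rmorph_nat.
have -> : rkhs_norm (0 : rkhs K) = 0.
  by apply: complexI; rewrite -rkhs_normE normr0.
by field.
Qed.

Lemma rkhs_dot_gt0 u : u != 0 -> 0 < rkhs_dot u u.
Proof. by move=> u0; rewrite rkhs_dotE exprn_gt0// normr_gt0. Qed.

Let rkhs_dot_bilinear : bilinear_for ( *%R : R[i] -> R[i] -> R[i])
  (conjc \; *%R : R[i] -> R[i] -> R[i]) rkhs_dot.
Proof.
split=> z a x y /=; first exact: rkhs_dotPl.
by rewrite rkhs_dotJ rkhs_dotPl conjcD conjcM -!rkhs_dotJ.
Qed.

Let rkhs_dot_hermitian u v : rkhs_dot u v =
  (-1) ^+ false * conjc (rkhs_dot v u).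
Proof. by rewrite expr0 mul1r rkhs_dotJ. Qed.

HB.instance Definition _ := @bilinear_isBilinear.Build R[i] (rkhs K) (rkhs K)
  R[i] _ _ rkhs_dot rkhs_dot_bilinear.
HB.instance Definition _ := @isHermitianSesquilinear.Build R[i] (rkhs K) false
  conjc rkhs_dot rkhs_dot_hermitian.
HB.instance Definition _ := isDotProduct.Build R[i] (rkhs K) rkhs_dot
  rkhs_dot_gt0.

Definition rkhs_hilbert : hilbertType R :=
  @HilbertType R (rkhs K) rkhs_dot (fun u => esym (rkhs_dotE u)).

Lemma rkhs_dot_comb l m :
  rkhs_dot (rkhs_comb l) (rkhs_comb m) = comb_dot K l m.
Proof.
rewrite /rkhs_dot rkhs_combZ !rkhs_rdot_comb comb_dot_scaler.
by case: (comb_dot K l m) => a b; simpc.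
Qed.

Definition rkhs_point x : rkhs K := rkhs_comb [:: (1, x)].

Lemma rkhs_dot_point x y : rkhs_dot (rkhs_point x) (rkhs_point y) = K x y.
Proof.
by rewrite rkhs_dot_comb -pairing_comb_fun pairing1 /comb_fun big_seq1 mul1r.
Qed.

End rkhs_dot.

(** * Unitaries from symmetries of a kernel *)

(** A bijection of the points that leaves the kernel invariant acts on functions
    by composition with its inverse; in this form the group laws hold pointwise,
    and no extension by continuity is necessary. *)
Record kernel_symmetry (R : realType) (X : Type) (K : psd_kernel R X) :=
  KernelSymmetry {
    symmetry_fun :> X -> X ;
    symmetry_inv : X -> X ;
    symmetryK : cancel symmetry_fun symmetry_inv ;
    symmetry_invK : cancel symmetry_inv symmetry_fun ;
    symmetry_kernel : forall x y, K (symmetry_fun x) (symmetry_fun y) = K x y }.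

Section symmetry.
Context {R : realType} {X : Type} {K : psd_kernel R X}.
Implicit Types (s : kernel_symmetry K) (u v : rkhs K).

Lemma rkhs_hilbert_normE (u : rkhs_hilbert K) : `|u| = (rkhs_norm u)%:C.
Proof. by []. Qed.

Definition inverse_symmetry s : kernel_symmetry K.
Proof.
apply: (@KernelSymmetry _ _ _ (symmetry_inv s) s); first exact: symmetry_invK.
  exact: symmetryK.
by move=> x y; rewrite -(symmetry_kernel s) !symmetry_invK.
Defined.

Definition comb_map (f : X -> X) (l : seq (R[i] * X)) :=
  [seq (p.1, f p.2) | p <- l].

Lemma comb_norm_map s l : comb_norm K (comb_map s l) = comb_norm K l.
Proof.
rewrite /comb_norm /comb_dot big_map; congr (Num.sqrt (Re _)).
apply: eq_bigr => p _; rewrite big_map; apply: eq_bigr => q _.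
by rewrite symmetry_kernel.
Qed.

Lemma bounded_by_symmetry s (f : X -> R[i]) c : bounded_by K f c ->
  bounded_by K (fun x => f (symmetry_inv s x)) c.
Proof.
move=> fc m; rewrite -(comb_norm_map (inverse_symmetry s) m).
by apply: le_trans (fc _); rewrite /pairing big_map.
Qed.

Lemma approximable_symmetry s (f : X -> R[i]) : approximable K f ->
  approximable K (fun x => f (symmetry_inv s x)).
Proof.
move=> fa e e0; have [l fl] := fa e e0; exists (comb_map s l).
apply: eq_bounded_by (bounded_by_symmetry s fl) => x; congr (_ - _).
rewrite /comb_fun big_map; apply: eq_bigr => p _ /=.
by rewrite -{2}(symmetry_invK s x) symmetry_kernel.
Qed.

Definition rkhs_symmetry s u : rkhs K :=
  Rkhs (approximable_symmetry s (rkhsP u)).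

Lemma rkhs_symmetry_norm s u : rkhs_norm (rkhs_symmetry s u) = rkhs_norm u.
Proof.
have le s' v : rkhs_norm (rkhs_symmetry s' v) <= rkhs_norm v.
  apply: rkhs_norm_le; first exact: rkhs_norm_ge0.
  exact: bounded_by_symmetry (@rkhs_norm_bound _ _ _ v).
apply/eqP; rewrite eq_le le/=.
have {1}-> : u = rkhs_symmetry (inverse_symmetry s) (rkhs_symmetry s u).
  by apply: rkhs_eq => x /=; rewrite symmetryK.
exact: le.
Qed.

Lemma rkhs_symmetryP s a u v :
  rkhs_symmetry s (a *: u + v) = a *: rkhs_symmetry s u + rkhs_symmetry s v.
Proof. exact: rkhs_eq. Qed.

Lemma rkhs_symmetry_bounded s : @bounded_op R (rkhs_hilbert K) (rkhs_hilbert K)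
  (rkhs_symmetry s).
Proof.
split; first exact: rkhs_symmetryP.
exists 1 => u; by rewrite mul1r !rkhs_hilbert_normE rkhs_symmetry_norm.
Qed.

Lemma rkhs_dot_symmetry s u v :
  rkhs_dot (rkhs_symmetry s u) (rkhs_symmetry s v) = rkhs_dot u v.
Proof.
have D w z : rkhs_rdot (rkhs_symmetry s w) (rkhs_symmetry s z) = rkhs_rdot w z.
  rewrite /rkhs_rdot -(rkhs_symmetry_norm s (w + z))
    -(rkhs_symmetry_norm s (w - z)).
  by congr (_ * (rkhs_norm _ ^+ 2 - rkhs_norm _ ^+ 2)); exact: rkhs_eq.
have Si : 'i *: rkhs_symmetry s v = rkhs_symmetry s ('i *: v) by exact: rkhs_eq.
by rewrite /rkhs_dot Si !D.
Qed.

Lemma rkhs_symmetry_point s x :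
  rkhs_symmetry s (rkhs_point K x) = rkhs_point K (s x).
Proof.
apply: rkhs_eq => y; rewrite /= /comb_fun !big_seq1 /=.
by rewrite -{2}(symmetry_invK s y) symmetry_kernel.
Qed.

Lemma rkhs_symmetry_adjoint s :
  @adjoint R (rkhs_hilbert K) (rkhs_hilbert K) (rkhs_symmetry s) =
  rkhs_symmetry (inverse_symmetry s).
Proof.
apply/funext => u; apply: adjoint_eq => v.
have E : rkhs_symmetry (inverse_symmetry s) (rkhs_symmetry s v) = v.
  by apply: rkhs_eq => x /=; rewrite symmetryK.
have := rkhs_dot_symmetry (inverse_symmetry s) (rkhs_symmetry s v) u.
by rewrite E; exact: esym.
Qed.

Lemma rkhs_symmetry_unitary s : @unitary R (rkhs_hilbert K) (rkhs_symmetry s).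
Proof.
split; first exact: rkhs_symmetry_bounded.
  apply/funext => u; rewrite rkhs_symmetry_adjoint.
  by apply: rkhs_eq => x /=; rewrite symmetryK.
apply/funext => u; rewrite rkhs_symmetry_adjoint.
by apply: rkhs_eq => x /=; rewrite symmetry_invK.
Qed.

End symmetry.

(** * The regular unitary dilation *)

(** The times of a finite subfamily of the semigroups. *)
Record finsupp_fun (R : realType) (I : choiceType) := FinsuppFun {
  finsupp_fun_fun :> I -> R ;
  finsupp_funP : finite_set [set i | finsupp_fun_fun i != 0] }.

Section finsupp.
Context {R : realType} {I : choiceType}.
Implicit Types g : finsupp_fun R I.

Lemma finsupp_fun_eq g g' : (forall i, g i = g' i) -> g = g'.
Proof.
case: g g' => [g gP] [g' gP'] /= /funext gg'; case: _ / gg' gP' => gP'.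
by congr FinsuppFun; exact: Prop_irrelevance.
Qed.

Definition support_seq g : seq I := fset_set [set i | g i != 0].

Lemma mem_support_seq g i : (i \in support_seq g) = (g i != 0).
Proof.
rewrite /support_seq in_fset_set; last exact: finsupp_funP.
by apply/idP/idP => [/set_mem//|gi]; exact/mem_set.
Qed.

Lemma finite_shift g i t : finite_set [set j | update g i (g i + t) j != 0].
Proof.
apply: (sub_finite_set (B := [set j | g j != 0] `|` [set i])).
  move=> j /=; have [ji _|ji] := eqVneq j i; first by right.
  by rewrite /update (negPf ji) => gj; left.
by rewrite finite_setU; split; [exact: finsupp_funP|exact: finite_set1].
Qed.

Definition shift i t g := FinsuppFun (finite_shift g i t).

Lemma shiftE i t g j : shift i t g j = g j + (if j == i then t else 0).
Proof. by rewrite /= /update; case: eqP => [->//|_]; rewrite addr0. Qed.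

Lemma shift_shift i s t g : shift i s (shift i t g) = shift i (s + t) g.
Proof.
apply: finsupp_fun_eq => j; rewrite !shiftE; case: eqP => _; ring.
Qed.

Lemma shift0 i g : shift i 0 g = g.
Proof. by apply: finsupp_fun_eq => j; rewrite shiftE if_same addr0. Qed.

Lemma shiftC i j s t g : shift i s (shift j t g) = shift j t (shift i s g).
Proof. by apply: finsupp_fun_eq => k; rewrite !shiftE addrAC. Qed.

Lemma finite_finsupp0 : finite_set [set i : I | (fun=> 0 : R) i != 0].
Proof.
rewrite (_ : [set i | _] = set0); first exact: finite_set0.
by apply/seteqP; split => i //=; rewrite eqxx.
Qed.

Definition finsupp0 := FinsuppFun finite_finsupp0.

End finsupp.

Section regular_dilation.
Context {R : realType} {H : hilbertType R} {I : choiceType}.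
Context (T : I -> R -> H -> H) (A : I -> H -> H).
Hypothesis T_semigroup : forall i, C0_semigroup (T i).
Hypothesis T_commute : commuting T.
Hypothesis A_generator : forall i, bounded_generator (T i) (A i).
Hypothesis A_positive : forall s : seq I, uniq s ->
  positive_form (dissipation_seq A s dotp).

Implicit Types (p q : finsupp_fun R I * H).

(** The value does not depend on the list of indices as long as it contains all
    indices where the times differ; this one is used as it always qualifies. *)
Definition dilation_kernel_fun p q : R[i] :=
  regular_kernel T (undup (support_seq p.1 ++ support_seq q.1)) dotp
    p.1 p.2 q.1 q.2.

Lemma dilation_kernel_funE (s : seq I) p q : uniq s ->
  (forall i, p.1 i != q.1 i -> i \in s) ->
  dilation_kernel_fun p q = regular_kernel T s dotp p.1 p.2 q.1 q.2.
Proof.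
move=> us pqs; rewrite /dilation_kernel_fun /regular_kernel.
have pqs' i : p.1 i != q.1 i -> i \in undup
  (support_seq p.1 ++ support_seq q.1).
  rewrite mem_undup mem_cat !mem_support_seq -negb_and; apply: contra.
  by move=> /andP[/eqP -> /eqP ->].
have E h : (forall i, h i != 0 -> p.1 i != q.1 i) ->
    semigroup_seq T (undup (support_seq p.1 ++ support_seq q.1)) h =
    semigroup_seq T s h.
  move=> hpq; apply: (semigroup_seq_indep T_semigroup T_commute) => //;
    first exact: undup_uniq.
    by move=> i /hpq; exact: pqs'.
  by move=> i /hpq; exact: pqs.
rewrite !E// => i; first by rewrite subr_eq0 eq_sym.
by rewrite subr_eq0.
Qed.

Lemma dilation_kernelJ p q : dilation_kernel_fun p q =
  (dilation_kernel_fun q p)^*.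
Proof.
rewrite (@dilation_kernel_funE (undup (support_seq p.1 ++ support_seq q.1)) q
  p).
- by rewrite -dotpJ.
- exact: undup_uniq.
- move=> i; rewrite mem_undup mem_cat !mem_support_seq -negb_and; apply: contra.
  by move=> /andP[/eqP -> /eqP ->].
Qed.

(** The coefficients are absorbed in the vectors, and all times are supported in
    a common list of indices. *)
Lemma dilation_kernel_psd (l : seq (R[i] * (finsupp_fun R I * H))) :
  0 <= \sum_(p <- l) \sum_(q <- l) p.1 * q.1^* * dilation_kernel_fun p.2 q.2.
Proof.
case: l => [|p0 l0]; first by rewrite big_nil.
move: (p0 :: l0) => l {l0}.
pose s := undup (flatten [seq support_seq (nth p0 l j).2.1 |
  j <- iota 0 (size l)]).
pose g j := (nth p0 l j).2.1 : I -> R.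
pose x j := (nth p0 l j).1 *: (nth p0 l j).2.2.
have := @regular_kernel_psd R H I T A T_semigroup T_commute A_generator s dotp
  (@bounded_form_dotp R H) _ (index_iota 0 (size l)) g x.
have ss J : subseq J s -> positive_form (dissipation_seq A J dotp).
  by move=> Js; apply: A_positive; apply: subseq_uniq Js (undup_uniq _).
move=> /(_ ss); congr (_ <= _).
rewrite (big_nth p0) big_seq [RHS]big_seq; apply: eq_bigr => j.
rewrite mem_index_iota => /andP[_ jl].
rewrite (big_nth p0) big_seq [RHS]big_seq; apply: eq_bigr => k.
rewrite mem_index_iota => /andP[_ kl].
rewrite (@dilation_kernel_funE s) ?undup_uniq//.
  rewrite /regular_kernel /x !(bounded_opZ
    (semigroup_seq_bounded T_semigroup _ _)).
  by rewrite dotpZl dotpZr mulrA.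
move=> i pq; rewrite mem_undup; apply/flattenP.
have : (g j i != 0) || (g k i != 0).
  by rewrite -negb_and; apply: contra pq => /andP[/eqP + /eqP];
    rewrite /g => -> ->.
case/orP => gi.
  exists (support_seq (nth p0 l j).2.1); last by rewrite mem_support_seq.
  by apply/mapP; exists j => //; rewrite mem_iota.
exists (support_seq (nth p0 l k).2.1); last by rewrite mem_support_seq.
by apply/mapP; exists k => //; rewrite mem_iota.
Qed.

Definition dilation_kernel : psd_kernel R (finsupp_fun R I * H) :=
  PsdKernel dilation_kernelJ dilation_kernel_psd.

Definition shift_point i t p := (shift i t p.1, p.2).

Lemma shift_pointK i t : cancel (shift_point i t) (shift_point i (- t)).
Proof. by move=> [g x]; rewrite /shift_point /= shift_shift addNr shift0. Qed.

Lemma shift_pointNK i t : cancel (shift_point i (- t)) (shift_point i t).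
Proof. by move=> [g x]; rewrite /shift_point /= shift_shift addrN shift0. Qed.

Lemma shift_point_kernel i t p q :
  dilation_kernel (shift_point i t p) (shift_point i t q) = dilation_kernel p q.
Proof.
rewrite /= [RHS](@dilation_kernel_funE
  (undup (support_seq p.1 ++ support_seq q.1))); last 2 first.
- exact: undup_uniq.
- move=> j; rewrite mem_undup mem_cat !mem_support_seq -negb_and; apply: contra.
  by move=> /andP[/eqP -> /eqP ->].
rewrite (@dilation_kernel_funE (undup (support_seq p.1 ++ support_seq q.1)));
  last 2 first.
- exact: undup_uniq.
- move=> j; rewrite ![(shift_point i t _).1]/(shift i t _) !shiftE => pq.
  rewrite mem_undup mem_cat !mem_support_seq -negb_and; apply: contra pq.
  by move=> /andP[/eqP -> /eqP ->].
rewrite /regular_kernel [_.2]/= [in X in dotp _ (_ X)]/=.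
have D (g g' : finsupp_fun R I) : (fun j => shift i t g j - shift i t g' j) =
  (fun j => g j - g' j).
  by apply/funext => j; rewrite !shiftE; ring.
by rewrite /shift_point !D.
Qed.

Definition shift_symmetry i t : kernel_symmetry dilation_kernel :=
  @KernelSymmetry _ _ dilation_kernel _ _
  (shift_pointK i t) (shift_pointNK i t) (shift_point_kernel i t).

Definition dilation_space := rkhs_hilbert dilation_kernel.

Definition dilation_group i t : dilation_space -> dilation_space :=
  rkhs_symmetry (shift_symmetry i t).

Definition dilation_embed (x : H) : dilation_space :=
  rkhs_point dilation_kernel (finsupp0, x).

Lemma dilation_dot_point p q :
  dotp (rkhs_point dilation_kernel p : dilation_space)
       (rkhs_point dilation_kernel q : dilation_space) =
         dilation_kernel_fun p q.
Proof. exact: rkhs_dot_point. Qed.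

Lemma dilation_kernel_same g x y : dilation_kernel_fun (g, x) (g, y) = dotp x y.
Proof. by rewrite (@dilation_kernel_funE [::])// => i; rewrite eqxx. Qed.

Lemma dilation_embedP a x y :
  dilation_embed (a *: x + y) = a *: dilation_embed x + dilation_embed y.
Proof.
apply: rkhs_eq => z; rewrite /= /comb_fun !big_seq1 !mul1r /=.
rewrite /dilation_kernel_fun /regular_kernel /=.
set s := undup _; have sb := semigroup_seq_bounded T_semigroup s
  (fun i => 0 - z.1 i).
have [lin _] := sb.
by rewrite lin dotpDl dotpZl.
Qed.

Lemma dilation_embed_bounded : bounded_op dilation_embed.
Proof.
split; first exact: dilation_embedP.
exists 1 => x; rewrite mul1r -(@ler_pXn2r _ 2)// ?nnegrE//.
by rewrite !normE dilation_dot_point dilation_kernel_same.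
Qed.

Lemma dilation_groupD i s t : dilation_group i (s + t) =
  dilation_group i s \o dilation_group i t.
Proof.
apply/funext => u; apply: rkhs_eq => -[g x] /=.
by rewrite /shift_point /= shift_shift opprD addrC.
Qed.

Lemma dilation_group0 i : dilation_group i 0 = idfun.
Proof.
apply/funext => u; apply: rkhs_eq => -[g x] /=.
by rewrite /shift_point /= oppr0 shift0.
Qed.

Lemma dilation_groupC i j s t : dilation_group i s \o dilation_group j t =
  dilation_group j t \o dilation_group i s.
Proof.
apply/funext => u; apply: rkhs_eq => -[g x] /=.
by rewrite /shift_point /= shiftC.
Qed.

Lemma dilation_groupB i t (u v : dilation_space) :
  dilation_group i t (u - v) = dilation_group i t u - dilation_group i t v.
Proof. exact: (bounded_opB (rkhs_symmetry_bounded (shift_symmetry i t))). Qed.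

Lemma dilation_group_norm i t (u : dilation_space) : `|dilation_group i t u| =
  `|u|.
Proof. by rewrite !rkhs_hilbert_normE rkhs_symmetry_norm. Qed.

Lemma dilation_group_unitary i t : unitary (dilation_group i t).
Proof. exact: rkhs_symmetry_unitary. Qed.

Lemma dilation_groupN i t : adjoint (dilation_group i t) =
  dilation_group i (- t).
Proof.
rewrite /dilation_group rkhs_symmetry_adjoint; apply/funext => u.
by apply: rkhs_eq => -[g x] /=; rewrite opprK.
Qed.

Lemma dilation_group_pointE i t p :
  dilation_group i t (rkhs_point dilation_kernel p) =
  rkhs_point dilation_kernel (shift_point i t p).
Proof. exact: rkhs_symmetry_point. Qed.

Lemma dilation_kernel_shift i t g x : 0 <= t ->
  dilation_kernel_fun (shift i t g, x) (g, x) = dotp (T i t x) x.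
Proof.
move=> t0; rewrite (@dilation_kernel_funE [:: i])//; last first.
  move=> j; rewrite mem_seq1; apply: contraNT => ji.
  by rewrite /= /update (negPf ji).
rewrite /regular_kernel /semigroup_seq /= /positive_part /update eqxx.
have -> : g i + t - g i = t by ring.
have -> : g i - (g i + t) = - t by ring.
by rewrite max_l// max_r ?oppr_le0// (semigroup0 T_semigroup).
Qed.

(** The squared distance of the points is 2 (|x| ^ 2 - Re <T i h x, x>). *)
Lemma dilation_group_point_cvg i p :
  dilation_group i h (rkhs_point dilation_kernel p) @[h --> (0 : R)^'+] -->
  (rkhs_point dilation_kernel p : dilation_space).
Proof.
case: p => g x; set k : dilation_space := rkhs_point _ _.
have TTx : Re (dotp (T i h x) x) @[h --> (0 : R)^'+] --> Re (dotp x x).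
  apply: cvg_Re; apply: (form_cvg (@bounded_form_dotp R H));
    last exact: cvg_cst.
  exact: semigroup_cvg0.
have sq h : 0 <= h -> sqnorm (dilation_group i h k - k) =
    (sqnorm x - Re (dotp (T i h x) x)) *+ 2.
  move=> h0; rewrite sqnormB /sqnorm dilation_group_pointE !dilation_dot_point.
  by rewrite !dilation_kernel_same dilation_kernel_shift//; ring.
have sq0 : (sqnorm x - Re (dotp (T i h x) x)) *+ 2 @[h --> (0 : R)^'+] --> 0.
  have : (sqnorm x - Re (dotp (T i h x) x)) *+ 2 @[h --> (0 : R)^'+] -->
      (sqnorm x - sqnorm x) *+ 2.
    by apply: cvgMn; apply: cvgB => //; exact: cvg_cst.
  by rewrite subrr mul0rn.
apply/cvgrPdist_lt => _ /gt0_complex [e e0 ->].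
have e20 : 0 < e ^+ 2 by rewrite exprn_gt0.
near=> h; have h0 : 0 < h by near: h; exact: nbhs_right_gt.
rewrite distrC -(@ltr_pXn2r _ 2)// ?nnegrE// ?ler0c ?ltW//.
rewrite normE sqnormE -rmorphXn/= ltcR sq ?ltW//.
by near: h; exact: (cvgr_lt _ sq0).
Unshelve. all: by end_near. Qed.

Lemma dilation_group_comb_cvg i l :
  dilation_group i h (rkhs_comb dilation_kernel l) @[h --> (0 : R)^'+] -->
  (rkhs_comb dilation_kernel l : dilation_space).
Proof.
elim: l => [|[a p] l IH].
  have -> : (fun h => dilation_group i h (rkhs_comb dilation_kernel [::])) =
      (fun=> (rkhs_comb dilation_kernel [::] : dilation_space)).
    by apply/funext => h; apply: rkhs_eq => x; rewrite /= /comb_fun !big_nil.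
  exact: cvg_cst.
have E : rkhs_comb dilation_kernel ((a, p) :: l) =
    a *: rkhs_point dilation_kernel p + rkhs_comb dilation_kernel l.
  rewrite rkhs_combZ rkhs_combD /comb_scale /= mulr1 //.
rewrite E; under eq_fun do rewrite /dilation_group rkhs_symmetryP.
apply: (@cvgD _ dilation_space) => //.
by apply: (@cvgZl_tmp _ dilation_space); exact: dilation_group_point_cvg.
Qed.

(** The operators are isometric and combinations of points are dense. *)
Lemma dilation_group_cvg0 i (u : dilation_space) :
  dilation_group i h u @[h --> (0 : R)^'+] --> u.
Proof.
have [l lu] := rkhs_comb_dense u.
apply/cvgrPdist_lt => _ /gt0_complex [e e0 ->].
have e30 : 0 < (e / 3)%:C by rewrite ltcR divr_gt0.
have /cvgrPdist_lt/(_ _ e30) [N _ /(_ N (leqnn N))] := lu.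
set v : dilation_space := rkhs_comb _ _ => uv.
have /cvgrPdist_lt/(_ _ e30) vv := @dilation_group_comb_cvg i (l N).
near=> h; have -> : u - dilation_group i h u =
    (u - v) + (v - dilation_group i h v) + dilation_group i h (v - u).
  by rewrite dilation_groupB !addrA !subrK.
rewrite (le_lt_trans (ler_normD _ _))// (_ : e = e / 3 + e / 3 + e / 3);
  last by field.
rewrite 2!rmorphD ltrD//; last by rewrite dilation_group_norm distrC.
rewrite (le_lt_trans (ler_normD _ _))// ltrD//.
by near: h; exact: vv.
Unshelve. all: by end_near. Qed.

Lemma dilation_group_distE i s t (u : dilation_space) :
  `|dilation_group i s u - dilation_group i t u| =
  `|u - dilation_group i `|t - s| u|.
Proof.
wlog st : s t / s <= t => [hw|].
  have [/hw//|/ltW ts] := leP s t.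
  by rewrite [LHS]distrC hw// [X in dilation_group i X _]distrC.
have -> : dilation_group i t u = dilation_group i s
  (dilation_group i (t - s) u).
  by rewrite -[RHS]/((dilation_group i s \o _) u) -dilation_groupD addrC subrK.
rewrite -dilation_groupB dilation_group_norm.
by rewrite ger0_norm// subr_ge0.
Qed.

Lemma dilation_group_continuous i (u : dilation_space) :
  continuous (fun t : R => dilation_group i t u).
Proof.
move=> s; apply/cvgrPdist_lt => e e0.
have /cvgrPdist_lt/(_ _ e0) [d /= d0 dP] := @dilation_group_cvg0 i u.
exists d => //= t; rewrite dilation_group_distE => std.
have [ts|ts] := eqVneq (`|t - s|) 0.
  by rewrite ts dilation_group0 subrr normr0.
apply: dP => /=; last by rewrite lt_neqAle eq_sym ts normr_ge0.
by rewrite sub0r normrN ger0_norm// distrC.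
Qed.

Lemma dilation_group_semigroup i : C0_semigroup (dilation_group i).
Proof.
split=> [t _||s t _ _|u].
- exact: rkhs_symmetry_bounded.
- exact: dilation_group0.
- exact: dilation_groupD.
- by apply: continuous_subspaceT; exact: dilation_group_continuous.
Qed.

Lemma extend_dilation_group i t : extend_group (dilation_group i) t =
  dilation_group i t.
Proof.
by rewrite /extend_group; case: leP => // _; rewrite dilation_groupN opprK.
Qed.

(** The times h are built up from 0 by successive shifts. *)
Lemma dilation_group_seq (s : seq I) (h : finsupp_fun R I) x : uniq s ->
  (forall i, h i != 0 -> i \in s) ->
  compose_seq s (fun i => dilation_group i (h i)) (dilation_embed x) =
  rkhs_point dilation_kernel (h, x).
Proof.
move=> us hs; suff : exists g : finsupp_fun R I,
    (forall i, g i = if i \in s then h i else 0) /\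
    compose_seq s (fun i => dilation_group i (h i)) (dilation_embed x) =
    rkhs_point dilation_kernel (g, x).
  move=> [g [gE ->]]; congr (rkhs_point _ (_, x)); apply: finsupp_fun_eq => i.
  by rewrite gE; case: ifPn => // /negP is_; apply/eqP;
    apply: contraTT isT => /=;
    rewrite eq_sym => /hs.
elim: s us {hs} => [_|i s IH /= /andP[is_ us]]; first by exists finsupp0.
have [g [gE ->]] := IH us; exists (shift i (h i) g); split=> [j|].
  rewrite shiftE gE inE; case: eqVneq => [->|_];
    first by rewrite (negPf is_) add0r.
  by rewrite addr0.
exact: dilation_group_pointE.
Qed.

(** Both sides applied to x represent the functional y |-> <T(t_-) y, T(t_+) x>:
    on the right this is the value of the kernel at the pairs (0, y) and
    (t, x). *)
Lemma dilation_regular (K : {fset I}) (t : K -> R) :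
  adjoint (prod_op (fun i : K => t i < 0) (fun i : K => T (val i) (- t i)))
    \o prod_op (fun i : K => 0 < t i) (fun i : K => T (val i) (t i))
  = adjoint dilation_embed
    \o prod_op predT (fun i : K => extend_group (dilation_group (val i)) (t i))
    \o dilation_embed.
Proof.
pose h0 i := oapp t 0 (insub i : option K).
have h0E (i : K) : h0 (val i) = t i by rewrite /h0 valK.
have h0K i : h0 i != 0 -> i \in K.
  by rewrite /h0; case: insubP => [j jK _ _|_]; rewrite ?eqxx.
have hfin : finite_set [set i | h0 i != 0].
  by apply: (sub_finite_set (B := [set` K]));
    [move=> i /= /h0K|exact: finite_fset].
pose h := FinsuppFun hfin; pose s := [seq val i | i <- index_enum K].
have us : uniq s by exact: uniq_val_index_enum.
have hs i : h i != 0 -> i \in s by rewrite mem_val_index_enum; exact: h0K.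
rewrite (prod_op_negative_part (f := h) T_semigroup h0E).
rewrite (prod_op_positive_part T_semigroup h0E) -/s.
have -> : prod_op predT (fun i : K => extend_group (dilation_group (val i))
  (t i)) =
    compose_seq s (fun i => dilation_group i (h i)).
  rewrite prod_op_compose_seq /s compose_seq_map;
    apply: eq_compose_seq => i _ /=.
  by rewrite extend_dilation_group h0E.
apply/funext => x; have := dilation_group_seq x us hs; rewrite /= => ->.
apply/esym/adjoint_eq => y; rewrite dilation_dot_point -adjointP; last first.
  exact: semigroup_seq_bounded.
rewrite (@dilation_kernel_funE s)//; last first.
  by move=> i; rewrite eq_sym; exact: hs.
rewrite /regular_kernel /=.
have -> : (fun i => 0 - h0 i) = (fun i => - h0 i) by apply/funext => i;
  rewrite sub0r.
have -> // : (fun i => h0 i - 0) = h0 by apply/funext => i; rewrite subr0.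
Qed.

Lemma dilation_exists : regular_unitary_dilation T.
Proof.
exists dilation_space, dilation_group, dilation_embed; split.
- exact: dilation_group_semigroup.
- by move=> i t _; exact: dilation_group_unitary.
- by move=> i j s t _ _; exact: dilation_groupC.
- exact: dilation_embed_bounded.
- exact: dilation_regular.
Qed.

End regular_dilation.

Theorem corollary4p5 (R : realType) (I : choiceType) (I_nonempty : inhabited I)
    (H : hilbertType R) (T : I -> R -> H -> H) (A : I -> H -> H)
    (T_semigroup : forall i, C0_semigroup (T i))
    (T_commute : commuting T)
    (A_generator : forall i, bounded_generator (T i) (A i)) :
  regular_unitary_dilation T <-> completely_dissipative A.
Proof.
have A_bounded i : bounded_op (A i) by case: (A_generator i).
rewrite completely_dissipativeP//; last first.
  exact: (generators_commute T_semigroup T_commute A_generator).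
split=> [[H' [U [r [U_semigroup U_unitary U_commute rb r_dilation]]]] s
  us|Apos].
  apply: (@dissipation_seq_cat_ge0 R H I T A T_semigroup A_generator [::] s us).
  move=> t t0.
  exact: (dilation_brehmer T_semigroup T_commute U_semigroup U_unitary U_commute
    rb r_dilation us t0).
exact: dilation_exists Apos.
Qed.
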